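(* Fix an integer $d\geq 2$ and one of the classical polar-space types with parameter $e>0$ (so $e\in\{1/2,1,3/2,2\}$). Put $$A=de+\binom d2,\qquad \alpha=\min\{1,e\},\qquad k_{d,e}=\left\lfloor\frac{2A}{\alpha}\right\rfloor+1 .$$ Let $\Gamma(q,d,e)$ be the dual polar graph of the rank-$d$ polar space of the fixed type over $\mathbb F_q$, and let $\mu$ denote metric dimension. As $q\to\infty$ through the admissible field orders for that type, $$\left(\frac{A}{e}+o(1)\right)q^e\;\leq\;\mu(\Gamma(q,d,e))\;\leq\; k_{d,e}\,(q^e+1),$$ where the $o(1)$ term tends to $0$ as $q\to\infty$ and the upper bound holds for all sufficiently large admissible $q$. Consequently, $\mu(\Gamma(q,d,e))=\Theta_{d,e}(q^e)$, i.e. $\mu(\Gamma(q,d,e))$ is bounded above and below by positive constant multiples of $q^e$ for all sufficiently large admissible $q$, the constants depending only on $d$ and $e$.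
   Context: Metric dimension: for a finite connected simple graph $G$ with graph distance $d(\cdot,\cdot)$, a set $S\subseteq V(G)$ is resolving if the map $x\mapsto (d(s,x))_{s\in S}$ is injective on $V(G)$; $\mu(G)$ is the minimum size of a resolving set. Classical polar spaces: let $q$ be a prime power and $V$ a finite-dimensional vector space over $\mathbb F_q$ carrying either a nondegenerate alternating or Hermitian form $\beta$, or a nondegenerate quadratic form $Q$ (nondegenerate: $Q(v)\neq 0$ for each nonzero $v$ in the radical of the polar form of $Q$). A subspace $X\leq V$ is singular if $\beta(x,y)=0$ for all $x,y\in X$ (alternating/Hermitian case), respectively $Q(x)=0$ for all $x\in X$ (quadratic case). The rank $d$ is the maximum vector-space dimension of a singular subspace; all maximal singular subspaces have dimension $d$ and are called generators. The types with their parameter $e$ are: - $W(2d-1,q)$: alternating form on $\mathbb F_q^{2d}$, $e=1$; - $Q(2d,q)$: parabolic quadratic form on $\mathbb F_q^{2d+1}$, $e=1$; - $Q^+(2d-1,q)$: hyperbolic quadratic form on $\mathbb F_q^{2d}$, $e=0$; - $Q^-(2d+1,q)$: elliptic quadratic form on $\mathbb F_q^{2d+2}$, $e=2$; - $H(2d-1,q)$, $q$ a square: Hermitian form on $\mathbb F_q^{2d}$, $e=1/2$; - $H(2d,q)$, $q$ a square: Hermitian form on $\mathbb F_q^{2d+1}$, $e=3/2$. The condition $e>0$ excludes only the hyperbolic family. Admissible field orders are prime powers $q$, required to be squares in the Hermitian cases. In each case every singular $(d-1)$-dimensional subspace lies in exactly $q^e+1$ generators. Dual polar graph: the vertices of $\Gamma(q,d,e)$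 are the generators, two being adjacent when they intersect in a subspace of dimension $d-1$. The graph distance is $d_\Gamma(X,Y)=d-\dim(X\cap Y)$. *)

(* Defs.v *)
From HB Require Import structures.
From mathcomp Require Import all_boot all_order all_algebra.
From mathcomp Require Import sesquilinear.
From mathcomp Require Import reals.

Set Implicit Arguments.
Unset Strict Implicit.
Unset Printing Implicit Defensive.

Import Order.TTheory GRing.Theory Num.Theory.
Local Open Scope ring_scope.

Section MetricDimension.
Variables (T : finType) (e : rel T).

Definition walkb (n : nat) (x y : T) : bool :=
  [exists p : n.-tuple T, path e x p && (last x p == y)].

(* A shortest walk has fewer than #|T| edges, so the search is exhaustive;
   the value #|T| plays the role of an infinite distance, and does not occur
   in connected graphs. *)
Definition gdist (x y : T) : nat :=
  find (fun n => walkb n x y) (iota 0 #|T|).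

Definition resolving (S : {set T}) : bool :=
  [forall x, forall y, [forall s in S, gdist s x == gdist s y] ==> (x == y)].

Definition metric_dim : nat :=
  #|[arg min_(S < [set: T] | resolving S) #|S| ]|.

End MetricDimension.

Section QuadraticForms.
Variables (F : fieldType) (V : lmodType F).

Definition polar (Q : V -> F) (x y : V) : F := Q (x + y) - Q x - Q y.

Record quadratic_form := QuadraticForm {
  qf_fun :> V -> F;
  qf_scale : forall (a : F) (x : V), qf_fun (a *: x) = a ^+ 2 * qf_fun x;
  qf_polar_l : forall y : V, scalar ((polar qf_fun)^~ y);
  qf_polar_r : forall x : V, scalar (polar qf_fun x)
}.

Definition qf_nondegenerate (Q : quadratic_form) : Prop :=
  forall v : V, v != 0 -> (forall w : V, polar Q v w = 0) -> Q v != 0.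

End QuadraticForms.

Variant form_kind := Alternating | Hermitian | Quadratic.

(* Alternating forms are skew-symmetric in every characteristic, so the
   library's type of skew-symmetric forms loses nothing.  An involutive
   nontrivial automorphism theta of F exists only if #|F| is a square. *)
Inductive nondegenerate_form (F : fieldType) (V : vectType F) :
    form_kind -> Type :=
| AlternatingForm (b : {skew_symmetric V}) of
    nondegenerate b & (forall x : V, b x x = 0) :
    nondegenerate_form V Alternating
| HermitianForm (theta : {rmorphism F -> F}) (b : {hermitian_sym V for theta})
    of involutive theta & ~ (theta =1 id) & nondegenerate b :
    nondegenerate_form V Hermitian
| NondegQuadraticForm (Q : quadratic_form V) of qf_nondegenerate Q :
    nondegenerate_form V Quadratic.

Variant polar_type :=
| TypeW        (* W(2d-1, q) *)
| TypeQ        (* Q(2d, q) *)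
| TypeQplus    (* Q^+(2d-1, q) *)
| TypeQminus   (* Q^-(2d+1, q) *)
| TypeHodd     (* H(2d-1, q) *)
| TypeHeven.   (* H(2d, q) *)

Definition type_kind (t : polar_type) : form_kind :=
  match t with
  | TypeW => Alternating
  | TypeQ | TypeQplus | TypeQminus => Quadratic
  | TypeHodd | TypeHeven => Hermitian
  end.

Definition type_dim (t : polar_type) (d : nat) : nat :=
  match t with
  | TypeW | TypeQplus | TypeHodd => d.*2
  | TypeQ | TypeHeven => d.*2.+1
  | TypeQminus => d.*2.+2
  end.

Definition type_param (R : realType) (t : polar_type) : R :=
  match t with
  | TypeW | TypeQ => 1
  | TypeQplus => 0
  | TypeQminus => 2
  | TypeHodd => 1 / 2
  | TypeHeven => 3 / 2
  end.

HB.instance Definition _ (F : finFieldType) (V : vectType F) :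
    isCountable {vspace V} :=
  CanIsCountable (@VectorInternalTheory.vs2mxK F V).

HB.instance Definition _ (F : finFieldType) (V : vectType F) :
    isFinite {vspace V} :=
  CanIsFinite (@VectorInternalTheory.vs2mxK F V).

Section Singular.
Variables (F : finFieldType) (n : nat) (k : form_kind).
Local Notation V := 'rV[F]_n.
Variable f : nondegenerate_form V k.

Definition singular (X : {vspace V}) : bool :=
  match f with
  | AlternatingForm b _ _ => [forall x in X, forall y in X, b x y == 0]
  | HermitianForm _ b _ _ _ => [forall x in X, forall y in X, b x y == 0]
  | NondegQuadraticForm Q _ => [forall x in X, Q x == 0]
  end.

Definition form_rank : nat := \max_(X : {vspace V} | singular X) \dim X.

Definition generator (X : {vspace V}) : bool :=
  singular X && [forall Y, (singular Y && (X <= Y)%VS) ==> (Y == X)].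

End Singular.

(* A nondegenerate quadratic form on F^(2d) is hyperbolic iff it has rank d, and
   one on F^(2d+2) is elliptic iff it has rank d; for the other types the rank
   condition holds automatically. *)
Record polar_space (t : polar_type) (d : nat) (F : finFieldType) := PolarSpace {
  ps_form : nondegenerate_form 'rV[F]_(type_dim t d) (type_kind t);
  ps_rank : form_rank ps_form = d
}.

Section DualPolarGraph.
Variables (t : polar_type) (d : nat) (F : finFieldType).
Variable P : polar_space t d F.

Definition dual_polar_vertex : finType :=
  {X : {vspace 'rV[F]_(type_dim t d)} | generator (ps_form P) X}.

Definition dual_polar_adj : rel dual_polar_vertex :=
  fun X Y => \dim (val X :&: val Y)%VS == d.-1.

End DualPolarGraph.

Arguments dual_polar_vertex {t d F} P.
Arguments dual_polar_adj {t d F} P.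

Section Constants.
Variables (R : realType) (d : nat) (e : R).

Definition const_A : R := d%:R * e + 'C(d, 2)%:R.

Definition const_alpha : R := Num.min 1 e.

Definition const_k : int := Num.floor (2 * const_A / const_alpha) + 1.

End Constants.

(* Main.v *)
(** Let s = q^e.  Every panel (singular subspace of dimension d-1) lies in
    exactly s+1 generators, and among these a generator X singles out one
    gate, which meets X in one dimension more than all the others do.

    Lower bound.  Counting flags (generator, panel) by the dimension of the
    intersection with a fixed generator X shows that exactly
    s^d q^(d choose 2) = q^A generators are at distance d from X, and that the
    fraction at smaller distance is at most q / ((q-1)(s-2)).  The distance to
    one landmark therefore carries at most about e ln q / s units of entropy,
    whereas a resolving set has to account for at least A ln q.

    Upper bound.  The generators through a panel U fail to separate X and Y
    only if X and Y have the same gate in U, and then this gate meets both of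
    them nontrivially.  Flag counting bounds the fraction of such panels by
    O(1/s + 1/q) = O(q^-alpha), so by averaging one can choose k panels one
    after another so that at most O(q^(2A - alpha k)) < 1 pairs stay
    unseparated. *)

Require Import Defs.
From mathcomp Require Import all_boot all_order all_algebra all_field.
From mathcomp Require Import sesquilinear.
From mathcomp Require Import zify ring.

Set Implicit Arguments.
Unset Strict Implicit.
Unset Printing Implicit Defensive.

Import Order.TTheory GRing.Theory Num.Theory.
Local Open Scope ring_scope.

(** * Subspaces over a finite field *)

(** A generator meets X nontrivially with frequency of order 1/s, and s + 1 generators pass through
    a panel, so counting gates that meet X alone would bound the fraction of bad panels only by
    O(1). The upper bound rests on the common gate W meeting X and Y at once. Either the two
    intersections differ, or they coincide and have dimension at least 2: both are of frequency
    O(1/s^2). Or they coincide in a single point of X :&: Y; as X and Y are distinct, this space is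
    at most a hyperplane of X, which costs a factor q and leaves O(1/(s q)). Multiplication by s + 1
    then gives O(1/s + 1/q).

    The three kinds of forms are merged in [polarity], which retains orthogonality, the singular
    vectors and one number [psecant]. The integer s is [psecant] times q^(n - 2d), and e enters only
    through s^2 = q^(2e). The counts are cross-multiplied identities and inequalities between
    natural numbers in q, s and d, so they are uniform over all spaces with these parameters. *)

Definition qint (q c : nat) : nat := (\sum_(i < c) q ^ i)%N.

Lemma qintS q c : qint q c.+1 = (qint q c + q ^ c)%N.
Proof. by rewrite /qint big_ord_recr. Qed.

Lemma qint_pred q c : (q.-1 * qint q c)%N = (q ^ c).-1.
Proof. by rewrite predn_exp. Qed.

Section Subspaces.
Variables (F : finFieldType) (n : nat).
Local Notation V := 'rV[F]_n.
Local Notation q := #|F|.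
Implicit Types (U W K X Y : {vspace V}) (x y v : V).

Let q_gt1 : (1 < q)%N. Proof. exact: finNzRing_gt1. Qed.

Lemma card_vs U : #|U| = (q ^ \dim U)%N. Proof. exact: card_vspace. Qed.

Lemma closed_span (p : pred V) :
  p 0 -> (forall a x y, p x -> p y -> p (a *: x + y)) -> <<enum p>>%VS =i p.
Proof.
move=> p0 pP v; apply/idP/idP => [/coord_span-> | pv]; last first.
  by rewrite memv_span ?mem_enum.
apply: (big_rec (fun u => p u)) => // i x _ px; apply: pP => //.
have : (enum p)`_i \in enum p by rewrite mem_nth // -cardE.
by rewrite mem_enum.
Qed.

(** Translation by a suitable multiple of [x0] carries the kernel onto each of the q fibres of [f]
    on U. *)
Lemma card_functional_ker (f : V -> F) U x0 :
    scalar f -> x0 \in U -> f x0 != 0 ->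
  (#|[pred x in U | f x == 0%R]| * q)%N = #|U|.
Proof.
move=> fP x0U fx0; rewrite mulnC.
rewrite -[RHS]sum1_card (partition_big f xpredT) //=.
rewrite -sum_nat_const; apply: eq_bigr => a _.
have fD x b : f (x + b *: x0) = f x + b * f x0.
  by rewrite addrC fP addrC.
rewrite -sum1_card.
rewrite [RHS](reindex_inj (addIr ((a / f x0) *: x0))) /=.
apply: eq_bigl => x; rewrite !inE fD divfK //.
have -> : (f x + a == a) = (f x == 0) by rewrite -subr_eq0 addrK.
by rewrite rpredDr // rpredZ.
Qed.

Lemma dimv_add_line U x : x \notin U -> \dim (U + <[x]>)%VS = (\dim U).+1.
Proof.
move=> xU; have x0 : x != 0 by apply: contraNneq xU => ->; rewrite mem0v.
rewrite dimv_disjoint_sum ?dim_vline ?x0 ?addn1 //.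
apply/eqP; rewrite -subv0; apply/subvP => v /memv_capP[vU /vlineP[a Ea]].
have [a0|a0] := eqVneq a 0; first by rewrite Ea a0 scale0r mem0v.
case/negP: xU; have -> : x = a^-1 *: v by rewrite Ea scalerA mulVf ?scale1r.
exact: rpredZ.
Qed.

Lemma eq_add_line U Z x :
  (U <= Z)%VS -> x \in Z -> x \notin U -> \dim Z = (\dim U).+1 ->
  Z = (U + <[x]>)%VS.
Proof.
move=> UZ xZ xU dZ; apply/esym/eqP; rewrite eqEdim dimv_add_line // dZ leqnn andbT.
by rewrite subv_add UZ -memvE.
Qed.

Lemma proper_vs_ex U W : ~~ (W <= U)%VS -> exists2 x, x \in W & x \notin U.
Proof. by move/subvPn=> [x]; exists x. Qed.

Lemma dim_ltn_ex U W : (\dim U < \dim W)%N -> exists2 x, x \in W & x \notin U.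
Proof.
by move=> lt; apply: proper_vs_ex; apply: contraL lt => /dimvS; rewrite -leqNgt.
Qed.

Definition hyper W U := (U <= W)%VS && ((\dim U).+1 == \dim W).

Lemma card_diff U W : (U <= W)%VS ->
  #|[pred v in W | v \notin U]| = (q ^ \dim W - q ^ \dim U)%N.
Proof.
move=> UW; rewrite -!card_vs.
have := cardID (mem U) (mem W).
have -> : #|[predI mem W & mem U]| = #|U|.
  apply: eq_card => v; rewrite !inE andbC; case vU: (v \in U) => //=.
  exact: (subvP UW).
move=> <-; rewrite addKn; apply: eq_card => v; by rewrite !inE andbC.
Qed.

(** Induction on the codimension of K, counting pairs of a hyperplane U above K and a vector v of U
    outside K: the hyperplanes through v are those above K + <[v]>. Codimension 1 is treated apart,
    because there the factor to be cancelled, q^(dim W - 1) - q^(dim K), vanishes. *)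
Lemma card_hyper W K : (K <= W)%VS ->
  #|[pred U | hyper W U && (K <= U)%VS]| = qint q (\dim W - \dim K).
Proof.
move Ec: (\dim W - \dim K)%N => c.
elim: c K Ec => [|c IHc] K Ec KW.
  rewrite /qint big_ord0; apply/eqP/pred0P => U /=.
  apply/negP => /andP[/andP[UW /eqP dU] /dimvS KU].
  by move: Ec (dimvS KW); lia.
have [c0|c_gt0] := posnP c.
  rewrite c0 qintS /qint big_ord0 expn0 add0n.
  transitivity #|pred1 K|; last by rewrite card1.
  apply: eq_card => U; rewrite !inE.
  apply/andP/eqP => [[/andP[UW /eqP dU] KU]|->].
    by apply/esym/eqP; rewrite eqEdim KU /=; move: Ec; lia.
  rewrite /hyper KW subvv; split=> //; apply/eqP; move: (dimvS KW) Ec; lia.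
have dK : \dim W = (\dim K + c.+1)%N by move: (dimvS KW) Ec; lia.
have cnt : (#|[pred U | hyper W U && (K <= U)%VS]| * (q ^ (\dim W).-1 - q ^ \dim K)
            = (q ^ \dim W - q ^ \dim K) * qint q c)%N.
  rewrite -sum_nat_const -card_diff // -sum_nat_const.
  under eq_bigr => U /andP[/andP[UW /eqP dU] KU].
    rewrite (_ : (\dim W).-1 = \dim U) -?dU // -card_diff // -sum1_card.
  over.
  have EX v : v \in W -> v \notin K ->
      (\sum_(U | hyper W U && (K <= U)%VS && (v \in U)) 1 = qint q c)%N.
    move=> vW vK; rewrite -(IHc (K + <[v]>)%VS) ?dimv_add_line //; first last.
    - by rewrite subv_add KW -memvE.
    - by rewrite dK; lia.
    by rewrite -sum1_card; apply: eq_bigl => U; rewrite !inE subv_add -memvE andbA.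
  rewrite (exchange_big_dep (fun v => (v \in W) && (v \notin K))) /=; last first.
    move=> U v /andP[/andP[UW _] _]; rewrite !inE => /andP[vU ->].
    by rewrite (subvP UW).
  apply: eq_big => [v|v]; first by rewrite !inE.
  move=> /andP[vW vK]; rewrite -(EX v) //; apply: eq_bigl => U; rewrite !inE.
  by rewrite vK !andbT.
move: cnt; rewrite dK addnS /= !(expnS, expnD) (mulnCA q).
set k := (q ^ \dim K)%N; set C := (q ^ c)%N; set h := #|_|; move=> cnt.
have k_gt0 : (0 < k)%N by rewrite expn_gt0; lia.
have C_gt1 : (1 < C)%N by rewrite -(exp1n c) ltn_exp2r.
have E := qint_pred q c; have E1 := qint_pred q c.+1.
rewrite expnS -/C in E E1; move: cnt.
have kB m : (k * m - k = k * m.-1)%N by rewrite -subn1 mulnBr muln1.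
rewrite !kB -E -E1 => cnt.
have : (h * (k * (q.-1 * qint q c)) = qint q c.+1 * (k * (q.-1 * qint q c)))%N.
  by rewrite cnt; ring.
by move/eqP; rewrite eqn_pmul2r ?E => [/eqP//|]; rewrite muln_gt0 k_gt0; lia.
Qed.

End Subspaces.

(** * Generators, panels and gates *)

(* pform is the alternating or Hermitian form itself, and the polar form of a
   quadratic form; psing tells which vectors are singular.  psecant is the
   number of points other than <[x]> on a hyperbolic line through <[x]>: q, the
   square root of q, or 1 according to the kind of the form. *)
Record polarity (F : finFieldType) (n : nat) := Polarity {
  pform : 'rV[F]_n -> 'rV[F]_n -> F;
  psing : pred 'rV[F]_n;
  pform_lin : forall y, scalar (pform^~ y);
  pform_sym : forall x y, pform x y = 0 -> pform y x = 0;
  psing0 : psing 0;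
  psing_self : forall x, psing x -> pform x x = 0;
  psing_comb : forall a x y,
    psing x -> psing y -> pform x y = 0 -> psing (a *: x + y);
  pnondeg : forall x, psing x -> (forall y, pform x y = 0) -> x = 0;
  psecant : nat;
  psecantP : forall x y, psing x -> pform x y != 0 ->
    #|[pred a | psing (y + a *: x)]| = psecant
}.

Section Polarity.
Variables (F : finFieldType) (n : nat) (P : polarity F n).
Local Notation V := 'rV[F]_n.
Local Notation q := #|F|.
Local Notation "x _|_ y" := (pform P x y == 0) (at level 70).
Implicit Types (U W X Y Z : {vspace V}) (x y v : V).

Let q_gt1 : (1 < q)%N. Proof. exact: finNzRing_gt1. Qed.

Lemma pform_symb x y : (x _|_ y) = (y _|_ x).
Proof. by apply/eqP/eqP => /pform_sym. Qed.

Lemma pformDl a x y z : pform P (a *: x + y) z = a * pform P x z + pform P y z.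
Proof. exact: (pform_lin P z a x y). Qed.

Lemma pform0l z : pform P 0 z = 0.
Proof.
have := pformDl 1 0 0 z; rewrite scaler0 addr0 mul1r => /eqP.
by rewrite -subr_eq subrr eq_sym => /eqP.
Qed.

Lemma ortho_comb a x y z : x _|_ z -> y _|_ z -> a *: x + y _|_ z.
Proof. by move=> /eqP xz /eqP yz; rewrite pformDl xz yz mulr0 addr0. Qed.

(** Orthogonality is imposed on the left argument, in which the form is linear; a Hermitian form is
    only semilinear on the right. [closed_span] then gives the expected members. *)
Definition perp U : {vspace V} :=
  <<enum [pred x | [forall u in U, x _|_ u]]>>%VS.

Lemma perpP U x : reflect (forall u, u \in U -> x _|_ u) (x \in perp U).
Proof.
rewrite closed_span /=; first exact: forall_inP.
  by apply/forall_inP => u _; rewrite pform0l.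
move=> a y z /forall_inP yU /forall_inP zU; apply/forall_inP => u uU.
by rewrite ortho_comb ?yU ?zU.
Qed.

Lemma sub_perpC X Y : (X <= perp Y)%VS = (Y <= perp X)%VS.
Proof.
wlog suff: X Y / (X <= perp Y)%VS -> (Y <= perp X)%VS.
  by move=> W; apply/idP/idP; apply: W.
move/subvP=> XY; apply/subvP => y yY; apply/perpP => x xX.
by rewrite pform_symb; move/perpP: (XY x xX); apply.
Qed.

Lemma perpS X Y : (X <= Y)%VS -> (perp Y <= perp X)%VS.
Proof.
move/subvP=> XY; apply/subvP => v /perpP vY; apply/perpP => x /XY; exact: vY.
Qed.

Lemma mem_perp_line x y : (x \in perp <[y]>%VS) = (x _|_ y).
Proof.
apply/perpP/idP => [->//|xy u /vlineP[a ->]]; first exact: memv_line.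
by rewrite pform_symb -[a *: y]addr0 ortho_comb // pform_symb // pform_symb pform0l.
Qed.

Lemma perpD X Y : perp (X + Y) = (perp X :&: perp Y)%VS.
Proof.
apply/eqP; rewrite eqEsubv subv_cap !perpS ?addvSl ?addvSr //=.
by rewrite sub_perpC subv_add sub_perpC capvSl sub_perpC capvSr.
Qed.

(** A vector of Y in [perp X] is orthogonal to all of X, any other to a fraction 1/q of it. Counting
    the same pairs from the side of X yields [card_perp]. *)
Lemma card_ortho_pairs X Y :
  (q * \sum_(y in Y) #|[pred x in X | x _|_ y]|)%N
  = (#|X| * (#|(Y :&: perp X)%VS| * q.-1 + #|Y|))%N.
Proof.
have E y : y \in Y -> (q * #|[pred x in X | x _|_ y]|)%N
    = (#|X| * ((y \in perp X) * q.-1 + 1))%N.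
  move=> yY; have [yX|] := boolP (y \in perp X).
    rewrite mul1n addn1 prednK 1?mulnC; last by lia.
    congr (_ * _)%N; apply: eq_card => x; rewrite !inE andbC.
    by case xX: (x \in X); rewrite ?andbF ?andbT // pform_symb; apply: (perpP _ _ yX).
  rewrite closed_span ?inE /=; last 2 first.
  - by apply/forall_inP => u _; rewrite pform0l.
  - move=> a u z /forall_inP yU /forall_inP zU; apply/forall_inP => w uU.
    by rewrite ortho_comb ?yU ?zU.
  case/forall_inPn => x0 x0X; rewrite pform_symb => xy.
  by rewrite mulnC (card_functional_ker (pform_lin P y) x0X xy) muln1.
rewrite big_distrr /=; under eq_bigr => y yY do rewrite (E y yY).
rewrite -big_distrr /= big_split /= sum1_card.
congr (_ * (_ + _))%N; rewrite -big_distrl /=; congr (_ * _)%N.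
rewrite -[RHS]sum1_card big_mkcond [RHS]big_mkcond; apply: eq_bigr => y _; rewrite memv_cap.
by case: (y \in Y) => //=; case: (y \in perp X).
Qed.

Lemma card_perp X Y :
  (#|X| * #|(Y :&: perp X)%VS| = #|Y| * #|(X :&: perp Y)%VS|)%N.
Proof.
have := card_ortho_pairs X Y; have := card_ortho_pairs Y X.
have -> : (\sum_(x in X) #|[pred y in Y | y _|_ x]|
          = \sum_(y in Y) #|[pred x in X | x _|_ y]|)%N.
  under eq_bigr do rewrite -sum1_card.
  under [RHS]eq_bigr do rewrite -sum1_card.
  rewrite (exchange_big_dep (mem Y)) /=; last by move=> i j _; rewrite inE => /andP[].
  apply: eq_bigr => y yY; apply: eq_bigl => x; rewrite !inE pform_symb.
  by rewrite yY.
move=> -> /eqP; rewrite !mulnDr [(#|X| * #|Y|)%N]mulnC eqn_add2r !mulnA eqn_pmul2r; last by lia.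
by move=> /eqP.
Qed.

(** A substitute for the formula dim X + dim (perp X) = n, which fails when the form has a radical,
    as the polar form of a parabolic quadric does in characteristic 2. For totally singular X the
    formula is recovered in [dim_perp]. *)
Lemma dim_perp_cap X Y :
  (\dim X + \dim (Y :&: perp X)%VS = \dim Y + \dim (X :&: perp Y)%VS)%N.
Proof.
have := card_perp X Y; rewrite !card_vs -!expnD => /eqP.
by rewrite eqn_exp2l // => /eqP.
Qed.

Definition tsing X := (X <= perp X)%VS && [forall x in X, psing P x].

Lemma tsingP X : reflect ((X <= perp X)%VS /\ forall x, x \in X -> psing P x) (tsing X).
Proof. by apply: (iffP andP) => -[? /forall_inP]. Qed.

Lemma tsing_perp X : tsing X -> (X <= perp X)%VS. Proof. by case/andP. Qed.

Lemma tsing_psing X x : tsing X -> x \in X -> psing P x.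
Proof. by case/tsingP=> _; apply. Qed.

Lemma tsing_add X Y : tsing X -> tsing Y -> (Y <= perp X)%VS -> tsing (X + Y).
Proof.
move=> /tsingP[XX sX] /tsingP[YY sY] YX; apply/tsingP; split.
  by rewrite perpD subv_cap !subv_add XX YX sub_perpC YX YY.
move=> _ /memv_addP[x xX [y yY ->]]; rewrite -[x]scale1r.
apply: psing_comb; [exact: sX|exact: sY|].
apply/eqP; rewrite pform_symb; move/subvP: YX => /(_ y yY) /perpP; exact.
Qed.

Lemma tsing_sub X Y : (X <= Y)%VS -> tsing Y -> tsing X.
Proof.
move=> XY /tsingP[YY sY]; apply/tsingP; split.
  exact: subv_trans XY (subv_trans YY (perpS XY)).
by move=> x /(subvP XY); apply: sY.
Qed.

Lemma tsing_line x : psing P x -> tsing <[x]>.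
Proof.
move=> sx; apply/tsingP; split.
  by rewrite -memvE mem_perp_line psing_self.
move=> _ /vlineP[a ->]; rewrite -[a *: x]addr0; apply: psing_comb => //.
  exact: psing0.
by apply/eqP; rewrite pform_symb pform0l.
Qed.

Lemma tsing_add_line X x : tsing X -> psing P x -> x \in perp X -> tsing (X + <[x]>).
Proof. by move=> tX sx xX; apply: tsing_add => //; exact: tsing_line. Qed.

(** Takes the place of Witt's theorem: X can be enlarged by a vector of any larger totally singular
    Y, so all maximal totally singular subspaces have the same dimension. *)
Lemma tsing_exchange X Y : tsing X -> tsing Y -> (\dim X < \dim Y)%N ->
  exists y, [/\ y \in Y, y \notin X & y \in perp X].
Proof.
move=> tX tY ltXY.
have le : (\dim (X :&: Y)%VS <= \dim (X :&: perp Y)%VS)%N.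
  by apply: dimvS; rewrite capvS // tsing_perp.
have [y] : exists2 y, y \in (Y :&: perp X)%VS & y \notin (X :&: Y)%VS.
  by apply: dim_ltn_ex; move: (dim_perp_cap X Y); lia.
rewrite !memv_cap => /andP[yY yX] nXY; exists y; split=> //.
by apply: contra nXY => ->.
Qed.

Lemma dim_perp X : tsing X -> (\dim X + \dim (perp X) = n)%N.
Proof.
move=> tX; have := dim_perp_cap X fullv; rewrite capfv dimvf /dim /= mul1n => ->.
suff -> : (X :&: perp fullv = 0)%VS by rewrite dimv0 addn0.
apply/eqP; rewrite -subv0; apply/subvP => x /memv_capP[xX /perpP xp].
rewrite memv0; apply/eqP/(@pnondeg _ _ P); first exact: tsing_psing tX xX.
by move=> y; apply/eqP/xp/memvf.
Qed.

Definition has_rank d :=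
  (forall X, tsing X -> (\dim X <= d)%N) /\ (exists2 X, tsing X & \dim X = d).

Section Rank.
Variable d : nat.
Hypothesis rkP : has_rank d.
Let rank_max X : tsing X -> (\dim X <= d)%N. Proof. by case: rkP => + _; apply. Qed.
Let rank_ex : exists2 X, tsing X & \dim X = d. Proof. by case: rkP. Qed.
Hypothesis d_gt0 : (0 < d)%N.

Definition gen X := tsing X && (\dim X == d).

Lemma gen_tsing X : gen X -> tsing X. Proof. by case/andP. Qed.
Lemma gen_dim X : gen X -> \dim X = d. Proof. by case/andP=> _ /eqP. Qed.

Lemma gen_maximal X : gen X <-> tsing X /\ forall Y, tsing Y -> (X <= Y)%VS -> Y = X.
Proof.
split=> [/andP[tX /eqP dX]|[tX mX]].
  split=> // Y tY XY; apply/esym/eqP; rewrite eqEdim XY dX; exact: rank_max.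
rewrite /gen tX eqn_leq rank_max //= leqNgt; apply/negP.
have [Y tY <-] := rank_ex; move=> /(tsing_exchange tX tY)[y [yY yX yp]].
have := mX (X + <[y]>)%VS; rewrite tsing_add_line ?(tsing_psing tY) // addvSl.
move=> /(_ isT isT) /(congr1 (fun Z => \dim Z)); rewrite dimv_add_line //; lia.
Qed.

Lemma gen_absorb X x : gen X -> psing P x -> x \in perp X -> x \in X.
Proof.
move=> /gen_maximal[tX mX] sx xp.
have <- := mX _ (tsing_add_line tX sx xp) (addvSl _ _).
by rewrite memvE addvSr.
Qed.

Lemma gen_above X : tsing X -> exists2 Y, gen Y & (X <= Y)%VS.
Proof.
move: {-1}(d - \dim X)%N (leqnn (d - \dim X)) => k.
elim: k X => [|k IHk] X lek tX; have := rank_max tX.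
  by exists X; rewrite ?subvv // /gen tX /=; apply/eqP; lia.
rewrite leq_eqVlt => /orP[/eqP dX|].
  by exists X; rewrite ?subvv // /gen tX /=; apply/eqP; lia.
have [Y tY dY] := rank_ex; rewrite -{1}dY => /(tsing_exchange tX tY)[y [yY yX yp]].
have [||Z gZ XZ] := IHk (X + <[y]>)%VS.
- by rewrite dimv_add_line //; lia.
- by rewrite tsing_add_line // (tsing_psing tY).
by exists Z => //; apply: subv_trans XZ; apply: addvSl.
Qed.

Lemma rank_bound : (d.*2 <= n)%N.
Proof.
have [X tX dX] := rank_ex; have := dim_perp tX.
have := dimvS (tsing_perp tX); rewrite dX; lia.
Qed.

Definition panel U := tsing U && (\dim U == d.-1).

Lemma hyper_panel U Y : gen Y -> hyper Y U -> panel U.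
Proof.
move=> gY /andP[UY /eqP dU]; rewrite /panel (tsing_sub UY (gen_tsing gY)).
by rewrite -(gen_dim gY) -dU /=.
Qed.

Lemma panel_hyper U Y : panel U -> gen Y -> hyper Y U = (U <= Y)%VS.
Proof.
move=> /andP[tU /eqP dU] gY; rewrite /hyper dU (gen_dim gY) prednK // eqxx andbT //.
Qed.

Definition pencil U := [pred Z | gen Z && (U <= Z)%VS].

(* The paper's q^e, as an integer. *)
Definition pencil_order := (psecant P * q ^ (n - d.*2))%N.

Section Panel.
Variables (U : {vspace V}).
Hypothesis pU : panel U.
Let tU : tsing U. Proof. by case/andP: pU. Qed.
Let dU : (\dim U).+1 = d. Proof. by case/andP: pU => _ /eqP->; rewrite prednK. Qed.

Lemma pencil_line Z x : gen Z -> (U <= Z)%VS -> x \in Z -> x \notin U ->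
  Z = (U + <[x]>)%VS.
Proof. by move=> gZ UZ xZ xU; apply: eq_add_line; rewrite // dU gen_dim. Qed.

Lemma panel_add_gen x : psing P x -> x \in perp U -> x \notin U -> gen (U + <[x]>).
Proof. by move=> sx xp xU; rewrite /gen tsing_add_line // dimv_add_line // dU /=. Qed.

Lemma pencil_perp Z x : gen Z -> (U <= Z)%VS -> x \in Z -> x \in perp U.
Proof.
move=> gZ UZ xZ; apply: (subvP (perpS UZ)).
by apply: (subvP (tsing_perp (gen_tsing gZ))).
Qed.

Lemma card_pencil : #|pencil U| = pencil_order.+1.
Proof.
have [Z0 gZ0 UZ0] := gen_above tU.
have [x xZ xU] : exists2 x, x \in Z0 & x \notin U.
  by apply: dim_ltn_ex; rewrite (gen_dim gZ0) -dU.
have sx : psing P x by apply: tsing_psing (gen_tsing gZ0) xZ.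
have xp : x \in perp U by apply: pencil_perp xZ.
have EZ0 := pencil_line gZ0 UZ0 xZ xU.
have dZ0p : (\dim (perp Z0) = n - d)%N.
  by have := dim_perp (gen_tsing gZ0); rewrite (gen_dim gZ0); lia.
have dUp : (\dim (perp U) = (n - d).+1)%N.
  by have := dim_perp tU; move: rank_bound; lia.
have mZ0p v : v \in perp U -> (v \in perp Z0) = (v _|_ x).
  by move=> vU; rewrite [X in perp X]EZ0 perpD memv_cap vU mem_perp_line.
(* Double counting of the singular vectors of perp U outside perp Z0: once on
   the lines in direction x, once in the generators through U other than Z0. *)
pose A := [pred v | [&& v \in perp U, ~~ (v _|_ x) & psing P v]].
have cA1 : (#|A| * q = (q ^ (n - d).+1 - q ^ (n - d)) * psecant P)%N.
  rewrite -dUp -[in RHS]dZ0p -card_diff ?perpS // -[RHS]sum_nat_const.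
  rewrite [RHS](eq_bigr (fun v : V => \sum_(a | psing P (v + a *: x)%R) 1)%N); last first.
    move=> v; rewrite inE => /andP[vU]; rewrite mZ0p // pform_symb => vx.
    by rewrite -(psecantP sx vx) sum1_card.
  rewrite (exchange_big_dep xpredT) //= mulnC -sum_nat_const.
  apply: eq_bigr => a _; rewrite -sum1_card.
  rewrite (reindex_inj (addIr (a *: x))) /=; apply: eq_bigl => v.
  rewrite !inE rpredDr ?rpredZ //; case vU: (v \in perp U) => //=.
  rewrite mZ0p // addrC pformDl psing_self // mulr0 add0r addrC.
  by rewrite andbC.
have cA2 : (#|A| = #|[predD1 pencil U & Z0]| * (q ^ d - q ^ d.-1))%N.
  rewrite -sum_nat_const.
  rewrite (eq_bigr (fun Z => \sum_(v in Z | v \notin U) 1)%N); last first.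
    move=> Z; rewrite !inE => /andP[_ /andP[gZ UZ]].
    by rewrite sum1_card card_diff // (gen_dim gZ) -dU.
  rewrite (exchange_big_dep (mem A)) /=; last first.
    move=> Z v; rewrite !inE => /andP[neZ /andP[gZ UZ]] /andP[vZ vU].
    have vp := pencil_perp gZ UZ vZ; have sv := tsing_psing (gen_tsing gZ) vZ.
    rewrite vp sv andbT /= -mZ0p //; apply: contra neZ => vZ0.
    by rewrite (pencil_line gZ UZ vZ vU) -(pencil_line gZ0 UZ0 _ vU) // gen_absorb.
  rewrite -sum1_card; apply: eq_bigr => v; rewrite inE => /and3P[vp vx sv].
  have vZ0 : v \notin Z0.
    apply: contra vx => vZ0; rewrite -mZ0p //.
    exact: (subvP (tsing_perp (gen_tsing gZ0))).
  have vU : v \notin U by apply: contra vZ0; apply: (subvP UZ0).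
  transitivity #|pred1 (U + <[v]>)%VS|; first by rewrite card1.
  rewrite -sum1_card; apply: eq_bigl => Z; rewrite !inE.
  apply/eqP/idP => [->|/andP[/andP[_ /andP[gZ UZ]] /andP[vZ _]]]; last exact: pencil_line.
  rewrite panel_add_gen // addvSl vU !andbT /= [v \in _]memvE addvSr andbT.
  by apply: contra vZ0 => /eqP <-; rewrite memvE addvSr.
rewrite (cardD1 Z0) inE gZ0 UZ0 add1n; congr _.+1; move: cA1; rewrite cA2 /pencil_order.
have -> : (n - d.*2 = n - d - d)%N by lia.
have le : (d <= n - d)%N by move: rank_bound; lia.
rewrite -{1 2}(subnK le); set m := (n - d - d)%N; set B := #|_|; rewrite -dU /=.
have eB k : (q ^ k.+1 - q ^ k = q.-1 * q ^ k)%N by rewrite expnS -subn1 mulnBl mul1n.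
rewrite !eB expnD expnS => E.
have : (B * (q.-1 * q ^ \dim U * q) = psecant P * q ^ m * (q.-1 * q ^ \dim U * q))%N.
  by rewrite mulnA E; ring.
move/eqP; rewrite eqn_pmul2r => [/eqP//|].
by rewrite !muln_gt0 expn_gt0; lia.
Qed.

Section Gate.
Variables (X : {vspace V}).
Hypothesis gX : gen X.

(** The vectors of X that can be joined to U are those orthogonal to U, and by [dim_cap_perp] they
    exceed U :&: X by exactly one dimension. The sum is therefore again a generator. *)
Definition gate := (U + (X :&: perp U))%VS.

Lemma cap_perp_panel : (U :&: (X :&: perp U) = U :&: X)%VS.
Proof.
by rewrite (capvC X) capvA; have /capv_idPl-> := tsing_perp tU.
Qed.

Lemma dim_cap_perp : \dim (X :&: perp U)%VS = (\dim (U :&: X)%VS).+1.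
Proof.
have := dim_perp_cap U X; rewrite (gen_dim gX).
have -> : (U :&: perp X = U :&: X)%VS.
  apply/eqP; rewrite eqEsubv; apply/andP; split; apply/subvP => v /memv_capP[vU vX].
    by rewrite memv_cap vU (gen_absorb gX (tsing_psing tU vU) vX).
  by rewrite memv_cap vU (subvP (tsing_perp (gen_tsing gX))).
lia.
Qed.

Lemma gate_gen : gen gate.
Proof.
rewrite /gen tsing_add ?capvSr //; last by rewrite (tsing_sub (capvSl _ _)) ?gen_tsing.
have := dimv_sum_cap U (X :&: perp U)%VS.
rewrite -/gate cap_perp_panel dim_cap_perp; move: dU => <- /=.
by rewrite eqn_leq; lia.
Qed.

Lemma gate_sub : (U <= gate)%VS. Proof. exact: addvSl. Qed.

Lemma dim_gate : \dim (gate :&: X) = (\dim (U :&: X)%VS).+1.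
Proof.
rewrite -dim_cap_perp; congr (\dim _); apply/eqP; rewrite eqEsubv !subv_cap.
rewrite capvSr capvSl addvSr /= !andbT.
apply: subv_trans (capvSl _ _) _; apply/subvP => v vg.
exact: pencil_perp gate_gen gate_sub vg.
Qed.

(** A vector of Z and X outside U is orthogonal to U, hence lies in the gate; together with U it
    spans both Z and the gate. *)
Lemma nongate_cap Z : gen Z -> (U <= Z)%VS -> Z != gate -> (Z :&: X = U :&: X)%VS.
Proof.
move=> gZ UZ; apply: contraNeq => ne.
have [x] : exists2 x, x \in (Z :&: X)%VS & x \notin U.
  apply: proper_vs_ex; apply: contraNN ne => ZXU.
  by rewrite eqEsubv !subv_cap ZXU !capvSr /= (subv_trans (capvSl _ _) UZ).
case/memv_capP=> xZ xX xU.
have xg : x \in gate.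
  by rewrite (subvP (addvSr _ _)) // memv_cap xX (pencil_perp gZ UZ).
apply/eqP; rewrite (pencil_line gZ UZ xZ xU); apply/esym.
exact: pencil_line gate_gen gate_sub xg xU.
Qed.

Lemma gateE Z : gen Z -> (U <= Z)%VS -> (Z == gate) = ~~ (Z :&: X <= U)%VS.
Proof.
move=> gZ UZ; apply/eqP/idP => [->|]; last first.
  apply: contraNeq => ne; rewrite nongate_cap //; exact: capvSl.
apply/negP => le; have := dim_gate; suff -> : (gate :&: X = U :&: X)%VS by lia.
by apply/eqP; rewrite eqEsubv !subv_cap le !capvSr (subv_trans (capvSl _ _) gate_sub).
Qed.

End Gate.
End Panel.
End Rank.
End Polarity.

(** * Counting generators by their intersections *)

Lemma qint_addn q a b : qint q (a + b) = (qint q a + q ^ a * qint q b)%N.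
Proof.
by elim: b => [|b IHb]; rewrite ?addn0 ?addnS /= ?qintS ?IHb /qint ?big_ord0 ?muln0 ?addn0 // mulnDr expnD addnA.
Qed.

Lemma qint_gt0 q a : (0 < qint q a.+1)%N.
Proof. by rewrite /qint big_ord_recl expn0. Qed.

Lemma qint_le2 q a : (1 < q)%N -> (qint q a.+1 <= 2 * q ^ a)%N.
Proof.
move=> q1; elim: a => [|a IHa]; first by rewrite /qint big_ord1 expn0.
by rewrite qintS expnS; nia.
Qed.

Lemma card_by_key (T : finType) (A : pred T) (k : T -> nat) m :
  (forall x, A x -> (k x < m)%N) ->
  #|A| = (\sum_(j < m) #|[pred x | A x && (k x == j)]|)%N.
Proof.
move=> km; under eq_bigr do rewrite -sum1_card.
rewrite (exchange_big_dep A) /=; last by move=> j x _ /andP[].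
rewrite -sum1_card; apply: eq_bigr => x Ax.
rewrite (eq_bigl (fun j : 'I_m => j == Ordinal (km x Ax))) ?big_pred1_eq // => j.
by rewrite !inE (Ax : A x = true) /= eq_sym.
Qed.

Section DualPolar.
Variables (F : finFieldType) (n : nat) (P : polarity F n) (d : nat).
Hypothesis rkP : has_rank P d.
Hypothesis d_gt0 : (0 < d)%N.
Local Notation V := 'rV[F]_n.
Local Notation q := #|F|.
Local Notation s := (pencil_order P d).
Local Notation gen := (gen P d).
Local Notation panel := (panel P d).
Local Notation pencil := (pencil P d).
Local Notation perp := (perp P).
Implicit Types (U W X Y Z : {vspace V}) (x y v : V) (m j : nat).

Let q_gt1 : (1 < q)%N. Proof. exact: finNzRing_gt1. Qed.

(** The common engine of the counts below: the weight [f] is chosen so that [card_hyper] evaluates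
    the inner sum on the left, and the gate property the one on the right. *)
Lemma flag_sum (f : {vspace V} -> {vspace V} -> nat) :
  (\sum_(W | gen W) \sum_(U | hyper W U) f W U
   = \sum_(U | panel U) \sum_(W in pencil U) f W U)%N.
Proof.
rewrite (exchange_big_dep panel) /=; last by move=> W U; apply: hyper_panel.
apply: eq_bigr => U pU; apply: eq_bigl => W; rewrite !inE.
by case gW: (gen W) => //=; rewrite (panel_hyper d_gt0 pU gW).
Qed.

Lemma card_hyperT W : gen W -> #|hyper W| = qint q d.
Proof.
move=> gW; have := card_hyper (sub0v W); rewrite dimv0 subn0 (gen_dim gW) => <-.
by apply: eq_card => U; rewrite !inE sub0v andbT.
Qed.

Lemma card_hyper_ge W K : gen W -> (K <= W)%VS ->
  #|[pred U | hyper W U && (K <= U)%VS]| = qint q (d - \dim K).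
Proof. by move=> gW KW; rewrite card_hyper // (gen_dim gW). Qed.

Lemma card_hyper_nge W K L : gen W -> (K <= W)%VS -> (L <= W)%VS ->
  #|[pred U | hyper W U && ((K <= U) && ~~ (L <= U))%VS]|
  = (qint q (d - \dim K) - qint q (d - \dim (K + L)))%N.
Proof.
move=> gW KW LW; have KLW : (K + L <= W)%VS by rewrite subv_add KW.
rewrite -(card_hyper_ge gW KW) -(card_hyper_ge gW KLW).
set A := [pred U | hyper W U && (K <= U)%VS].
rewrite -(cardID [pred U | (L <= U)%VS] A).
have -> : #|[predI A & [pred U | (L <= U)%VS]]| = #|[pred U | hyper W U && (K + L <= U)%VS]|.
  by apply: eq_card => U; rewrite !inE subv_add andbA.
rewrite addKn; apply: eq_card => U; rewrite !inE.
by case: (hyper W U); case: (K <= U)%VS; case: (L <= U)%VS.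
Qed.

Lemma card_flags : (#|gen| * qint q d = #|panel| * s.+1)%N.
Proof.
have := flag_sum (fun _ _ => 1%N).
rewrite (eq_bigr (fun=> qint q d)); last first.
  by move=> W gW; rewrite sum1_card card_hyperT.
rewrite [RHS](eq_bigr (fun=> s.+1)); last first.
  by move=> U pU; rewrite sum1_card card_pencil.
by rewrite !sum_nat_const.
Qed.

Definition nmeet X m := #|[pred W | gen W && (\dim (W :&: X) == m)]|.

Lemma dim_cap_le W X : gen W -> (\dim (W :&: X) <= d)%N.
Proof. by move=> /gen_dim <-; apply: dimvS; apply: capvSl. Qed.

(* Both sides count flags (W, U) over panels U with dim (U :&: X) = m: W is the
   gate of X on the left, and one of the s other generators on the right. *)
Lemma nmeet_rec X m : gen X -> (m < d)%N ->
  (s * (q ^ (d - m.+1) * qint q m.+1) * nmeet X m.+1 = qint q (d - m) * nmeet X m)%N.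
Proof.
move=> gX m_lt.
have := flag_sum (fun W U => (\dim (W :&: X) == m.+1) && ~~ (W :&: X <= U)%VS : nat).
rewrite (eq_bigr (fun W => ((\dim (W :&: X) == m.+1) * (q ^ (d - m.+1) * qint q m.+1))%N)); last first.
  move=> W gW; case: eqP => [Em|_]; last by rewrite big1.
  have := card_hyper_nge gW (sub0v W) (capvSl W X).
  rewrite dimv0 subn0 add0v Em.
  have -> : qint q d = (qint q (d - m.+1) + q ^ (d - m.+1) * qint q m.+1)%N.
    by rewrite -qint_addn subnK.
  rewrite addKn mul1n => <-.
  rewrite -sum1_card -big_mkcondr; apply: eq_bigl => U; rewrite inE sub0v.
  by [].
rewrite [RHS](eq_bigr (fun U => (\dim (U :&: X) == m) : nat)); last first.
  move=> U pU; have gg := gate_gen rkP d_gt0 pU gX; have gs := gate_sub P U X.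
  have gE := gateE rkP d_gt0 pU gX.
  rewrite (bigD1 (gate P U X)) ?inE ?gg ?gs //=.
  rewrite (dim_gate rkP d_gt0 pU gX) eqSS -gE // eqxx andbT.
  rewrite big1 ?addn0 // => W; rewrite inE -andbA => /and3P[gW UW ne].
  by rewrite -gE // (negPf ne) andbF.
rewrite -big_distrl /= => E1.
have := flag_sum (fun W U => (\dim (W :&: X) == m) && (W :&: X <= U)%VS : nat).
rewrite (eq_bigr (fun W => ((\dim (W :&: X) == m) * qint q (d - m))%N)); last first.
  move=> W gW; case: eqP => [Em|_]; last by rewrite big1.
  rewrite -Em mul1n -(card_hyper_ge gW (capvSl W X)).
  by rewrite -sum1_card -big_mkcondr.
rewrite [RHS](eq_bigr (fun U => ((\dim (U :&: X) == m) * s)%N)); last first.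
  move=> U pU; have gg := gate_gen rkP d_gt0 pU gX; have gs := gate_sub P U X.
  have := card_pencil rkP d_gt0 pU.
  rewrite (cardD1 (gate P U X)) inE gg gs add1n => -[<-].
  rewrite (bigD1 (gate P U X)) ?inE ?gg ?gs //=.
  have := gateE rkP d_gt0 pU gX gg gs.
  rewrite eqxx => /esym/negPf->; rewrite andbF add0n.
  rewrite -sum1_card big_distrr /=; apply: eq_big => [W|W].
    by rewrite !inE andbC.
  rewrite !inE -andbA => /and3P[gW UW ne].
  rewrite (nongate_cap rkP d_gt0 pU gX gW UW ne) muln1.
  by rewrite capvSl andbT.
rewrite -!big_distrl /= -E1 => E2.
have nE j : nmeet X j = (\sum_(W | gen W) (\dim (W :&: X) == j))%N.
  by rewrite /nmeet -sum1_card -big_mkcondr.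
by rewrite !nE [RHS]mulnC E2; ring.
Qed.

Lemma nmeet_d X : gen X -> nmeet X d = 1%N.
Proof.
move=> gX; rewrite -(card1 X); apply: eq_card => W; rewrite !inE.
apply/andP/eqP => [[gW /eqP dW]|->]; last by rewrite capvv (gen_dim gX).
have WX : (W :&: X = W)%VS by apply/eqP; rewrite eqEdim capvSl dW (gen_dim gW) /=.
by apply/eqP; rewrite eqEdim -{1}WX capvSr (gen_dim gW) (gen_dim gX) /=.
Qed.

Definition qfact q m := (\prod_(i < m) qint q i.+1)%N.

Lemma qfact_gt0 m : (0 < qfact q m)%N.
Proof. by rewrite prodn_gt0 // => i; apply: qint_gt0. Qed.

Lemma nmeet0 X : gen X -> nmeet X 0 = (s ^ d * q ^ 'C(d, 2))%N.
Proof.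
move=> gX.
(* The closed form is s^i q^(i choose 2) times the Gaussian binomial of d over i, with denominators
   cleared by q-factorials. Here i is the distance from X. *)
have H i : (i <= d)%N -> (nmeet X (d - i) * (qfact q i * qfact q (d - i))
   = s ^ i * q ^ 'C(i, 2) * qfact q d)%N.
  elim: i => [_|i IHi id].
    by rewrite subn0 nmeet_d // /qfact big_ord0 expn0 !mul1n.
  have := IHi (ltnW id); have := @nmeet_rec X (d - i.+1) gX.
  have -> : (d - i = (d - i.+1).+1)%N by lia.
  set m := (d - i.+1)%N => /(_ ltac:(lia)).
  have -> : (d - m.+1 = i)%N by lia.
  have -> : (d - m = i.+1)%N by lia.
  rewrite {2}/qfact big_ord_recr /= -/(qfact q m) => E1 E2.
  rewrite {1}/qfact big_ord_recr /= -/(qfact q i) binS bin1 expnS expnD.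
  transitivity ((qint q i.+1 * nmeet X m) * (qfact q i * qfact q m))%N; first by ring.
  rewrite -E1.
  transitivity (s * q ^ i * (nmeet X m.+1 * (qfact q i * (qfact q m * qint q m.+1))))%N.
    by ring.
  by rewrite E2; ring.
have := H d (leqnn d); rewrite subnn {2}/qfact big_ord0 muln1 => /eqP.
by rewrite eqn_pmul2r ?qfact_gt0 // => /eqP.
Qed.

Definition nmeet_ge X m := #|[pred W | gen W && (m <= \dim (W :&: X))%N]|.

Lemma nmeet_geS X m : nmeet_ge X m = (nmeet X m + nmeet_ge X m.+1)%N.
Proof.
rewrite /nmeet_ge -(cardID [pred W | \dim (W :&: X) == m]); congr (_ + _)%N.
  by apply: eq_card => W; rewrite !inE; case: gen => //=; lia.
by apply: eq_card => W; rewrite !inE; case: gen => //=; lia.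
Qed.

(** By [nmeet_rec], the ratio of consecutive terms is qint q (d - j) / (s q^(d - j - 1) qint q (j +
    1)), at most 2/s by [qint_le2]. The terms are then summed from the top dimension downwards. *)
Lemma nmeet_ge_half X m : gen X -> (0 < m)%N -> (s * nmeet_ge X m.+1 <= 2 * nmeet_ge X m)%N.
Proof.
move=> gX m0.
have step j : (0 < j < d)%N -> (s * nmeet X j.+1 <= 2 * nmeet X j)%N.
  move=> jd; have := nmeet_rec gX (proj2 (andP jd)).
  have -> : (d - j = (d - j.+1).+1)%N by lia.
  have := qint_le2 (d - j.+1) q_gt1; have := qint_gt0 q j.
  have : (0 < q ^ (d - j.+1))%N by rewrite expn_gt0; lia.
  set a := (q ^ _)%N; set b := qint q j.+1; set c := qint q _; move=> a0 b0 c_le E.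
  rewrite -(leq_pmul2l a0); apply: (@leq_trans (c * nmeet X j)).
    by rewrite -E; apply: (@leq_trans (s * (a * 1) * nmeet X j.+1)); [rewrite -!mulnA; nia|rewrite !leq_mul2r leq_mul2l leq_mul2l b0 !orbT].
  by rewrite (mulnCA a) mulnA leq_mul2r c_le orbT.
move: {-1}(d.+1 - m)%N (leqnn (d.+1 - m)) => k; elim: k m m0 => [|k IHk] m m0 km.
  have -> : nmeet_ge X m.+1 = 0%N; last by rewrite muln0.
  apply/eqP/pred0P => W /=; apply/negP => /andP[gW]; have := dim_cap_le X gW; lia.
have [md|dm] := ltnP m d; last first.
  have -> : nmeet_ge X m.+1 = 0%N; last by rewrite muln0.
  apply/eqP/pred0P => W /=; apply/negP => /andP[gW]; have := dim_cap_le X gW; lia.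
rewrite [nmeet_ge X m]nmeet_geS [in leqLHS]nmeet_geS !mulnDr leq_add ?step ?m0 //.
by apply: IHk; lia.
Qed.

Lemma nmeet_ge0 X : nmeet_ge X 0 = #|gen|.
Proof. by apply: eq_card => W; rewrite !inE andbT. Qed.

(** Intersections of dimension 1 dominate: by [nmeet_ge_half] the larger ones make up at most a
    fraction 2/s, whence the factor s - 2. The factor q / (q - 1) bounds qint q d / q^(d - 1). *)
Lemma nmeet_ge1_le X : gen X ->
  (nmeet_ge X 1 * (s - 2) * q.-1 <= q * #|gen|)%N.
Proof.
move=> gX; have h2 := nmeet_ge_half gX (leqnn 1); have h1 := nmeet_geS X 1.
have r0 := nmeet_rec gX d_gt0; rewrite subn0 in r0.
have := qint_pred q d; have h0 := nmeet_geS X 0; rewrite nmeet_ge0 in h0.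
move=> hq.
have q1E : qint q 1 = 1%N by rewrite /qint big_ord1.
rewrite q1E muln1 in r0.
have a0 : (0 < q ^ (d - 1))%N by rewrite expn_gt0; lia.
rewrite -(leq_pmul2l a0).
have e1 : (nmeet_ge X 1 * (s - 2) <= s * nmeet X 1)%N by nia.
apply: (@leq_trans (s * q ^ (d - 1) * nmeet X 1 * q.-1)).
  by rewrite !mulnA leq_mul2r -mulnA mulnC (mulnAC s) leq_mul2r e1 !orbT.
rewrite r0 mulnAC [(_ * q.-1)%N]mulnC hq.
have -> : (q ^ d = q * q ^ (d - 1))%N by rewrite -expnS; congr (_ ^ _)%N; lia.
rewrite h0; apply: (@leq_trans ((q * q ^ (d - 1)) * nmeet X 0)).
  by rewrite leq_mul2r leq_pred orbT.
by rewrite mulnA [(_ ^ _ * q)%N]mulnC leq_mul2l leq_addr orbT.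
Qed.

Definition meet_nsub X Y := [pred W | gen W &&
  ((0 < \dim (W :&: Y))%N && ~~ (W :&: X <= W :&: Y)%VS)].

(* In a flag (W, U) with W :&: Y <= U and U not containing W :&: X, W is the gate
   of X; so it can be traded for any of the s generators through U other than the
   gate of Y, all of which meet Y in W :&: Y. *)
Lemma card_meet_nsub X Y : gen X -> gen Y ->
  (s * #|meet_nsub X Y| <= 2 * nmeet_ge Y 1)%N.
Proof.
move=> gX gY.
have step j : (j < d)%N ->
    (s * #|[pred W | meet_nsub X Y W && (\dim (W :&: Y) == j)]| <= 2 * nmeet Y j)%N.
  move=> jd; set A := [pred W | _].
  pose f W U := (A W && ((W :&: Y <= U) && ~~ (W :&: X <= U))%VS : nat).
  pose g W U := ((\dim (W :&: Y) == j) && (W :&: Y <= U)%VS : nat).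
  have fsum : (#|A| * q ^ (d - j.+1) <= \sum_(W | gen W) \sum_(U | hyper W U) f W U)%N.
    rewrite -sum_nat_const [leqRHS](bigID A) /=; apply: leq_trans (leq_addr _ _).
    rewrite [leqRHS](eq_bigl (mem A)); last first.
      by move=> W; rewrite !inE; case: (gen W).
    apply: leq_sum => W AW; have := AW; rewrite inE => /andP[/andP[gW /andP[_ nsub]] /eqP dj].
    have := card_hyper_nge gW (capvSl W Y) (capvSl W X); rewrite dj.
    have : (j < \dim ((W :&: Y) + (W :&: X))%VS)%N.
      rewrite -dj ltn_neqAle dimvS ?addvSl // andbT; apply: contra nsub => /eqP E.
      suff -> : (W :&: Y = (W :&: Y) + (W :&: X))%VS by apply: addvSr.
      by apply/eqP; rewrite eqEdim addvSl E /=.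
    set j' := \dim _ => jj' E.
    apply: (@leq_trans (qint q (d - j) - qint q (d - j'))); last first.
      rewrite -E -sum1_card -big_mkcondr leq_eqVlt; apply/orP; left; apply/eqP.
      by apply: eq_bigl => U; rewrite inE (AW : A W = true).
    have -> : (d - j = (d - j.+1).+1)%N by lia.
    have le : (d - j' <= d - j.+1)%N by lia.
    have le2 : (qint q (d - j') <= qint q (d - j.+1))%N.
      by rewrite -[in leqRHS](subnKC le) qint_addn leq_addr.
    by rewrite qintS -addnBAC // leq_addl.
  have gsum : (\sum_(W | gen W) \sum_(U | hyper W U) g W U = nmeet Y j * qint q (d - j))%N.
    rewrite -sum_nat_const (bigID (fun W => \dim (W :&: Y) == j)) /= [X in (_ + X)%N]big1 ?addn0.
      apply: eq_big => [W|W /andP[gW /eqP dj]]; first by rewrite inE.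
      rewrite -dj -(card_hyper_ge gW (capvSl W Y)) -sum1_card -big_mkcondr.
      by apply: eq_bigl => U; rewrite inE dj eqxx.
    by move=> W /andP[_ /negPf dj]; rewrite big1 // => U _; rewrite /g dj.
  have fg : (s * (\sum_(W | gen W) \sum_(U | hyper W U) f W U)
             <= \sum_(W | gen W) \sum_(U | hyper W U) g W U)%N.
    rewrite !(flag_sum) big_distrr /=; apply: leq_sum => U pU.
    have gg := gate_gen rkP d_gt0 pU gY; have gs := gate_sub P U Y.
    have [->|] := eqVneq (\sum_(W in pencil U) f W U)%N 0%N; first by rewrite muln0.
    rewrite sum_nat_eq0 negb_forall => /existsP[W0]; rewrite negb_imply.
    rewrite inE => /andP[/andP[gW0 UW0]]; rewrite eqb0 negbK => /andP[AW0 /andP[YU0 XU0]].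
    have dU : \dim (U :&: Y)%VS = j.
      move: AW0; rewrite inE => /andP[_ /eqP <-]; congr (\dim _); apply/eqP.
      by rewrite eqEsubv !subv_cap YU0 !capvSr /= (subv_trans (capvSl _ _) UW0).
    have cp := card_pencil rkP d_gt0 pU.
    rewrite (cardD1 (gate P U Y)) inE gg gs add1n in cp; case: cp => cp.
    have -> : (\sum_(W in pencil U) f W U = 1)%N.
      rewrite (bigD1 W0) ?inE ?gW0 ?UW0 //= big1 ?addn0 => [|W].
        by rewrite /f AW0 YU0 XU0.
      rewrite inE -andbA => /and3P[gW UW ne]; rewrite /f.
      case: (boolP (W :&: X <= U)%VS) => [|nWX]; rewrite ?andbF //.
      have gE := gateE rkP d_gt0 pU gX; move: ne.
      have /eqP-> : W == gate P U X by rewrite gE.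
      have /eqP-> : W0 == gate P U X by rewrite gE.
      by rewrite eqxx.
    rewrite muln1 -cp -sum1_card [leqRHS](bigD1 (gate P U Y)) ?inE ?gg ?gs //=.
    apply: leq_trans (leq_addl _ _).
    rewrite [leqRHS](eq_bigl (mem [predD1 pencil U & gate P U Y])); last first.
      by move=> W; rewrite !inE andbC.
    apply: leq_sum => W /andP[ne /andP[gW UW]].
    by rewrite /g (nongate_cap rkP d_gt0 pU gY gW UW ne) dU eqxx capvSl.
  have a0 : (0 < q ^ (d - j.+1))%N by rewrite expn_gt0; lia.
  rewrite -(leq_pmul2r a0).
  apply: (@leq_trans (nmeet Y j * qint q (d - j))).
    by rewrite -gsum -mulnA; apply: leq_trans fg; rewrite leq_mul2l fsum orbT.
  have -> : (d - j = (d - j.+1).+1)%N by lia.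
  by rewrite mulnAC mulnC leq_mul2r qint_le2 // orbT.
rewrite (@card_by_key _ (meet_nsub X Y) (fun W => \dim (W :&: Y)) d); last first.
  move=> W /andP[gW /andP[_]]; apply: contraR; rewrite -leqNgt => dW.
  have WY : (W :&: Y = W)%VS.
    by apply/eqP; rewrite eqEdim capvSl (gen_dim gW).
  by rewrite WY capvSl.
rewrite /nmeet_ge [X in (_ <= 2 * X)%N](@card_by_key _ _ (fun W => \dim (W :&: Y)) d.+1); last first.
  by move=> W /andP[gW _]; rewrite ltnS (dim_cap_le Y gW).
rewrite big_ord_recr /= mulnDr !big_distrr /=; apply: leq_trans (leq_addr _ _).
apply: leq_sum => j _; have [j0|j0] := posnP j.
  by rewrite eq_card0 ?muln0 // => W; rewrite !inE j0; lia.
apply: leq_trans (step j (ltn_ord j)) _; rewrite leq_mul2l /= /nmeet.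
apply: subset_leq_card; apply/subsetP => W; rewrite !inE => /andP[-> /eqP->].
by rewrite eqxx j0.
Qed.

Definition meet_line X Y := [pred W | gen W &&
  ((W :&: X == W :&: Y)%VS && (\dim (W :&: X) == 1)%N)].

(* Flags (W, U) with U missing the common point, completed by W' in the pencil
   and a nonzero x in W; U is recovered from W' and x as W' :&: perp <[x]>. *)
Lemma card_meet_line X Y : gen X -> gen Y -> X != Y ->
  (s * q.-1 * #|meet_line X Y| <= #|gen|)%N.
Proof.
move=> gX gY neXY.
pose f W U := (meet_line X Y W && ~~ (W :&: X <= U)%VS : nat).
pose D := [pred x | (x \in (X :&: Y)%VS) && (x != 0)].
pose g W U := ((\dim (W :&: X) == 0)%N * #|[pred x | D x && (x \in perp U)]|)%N.
have fsum : (\sum_(W | gen W) \sum_(U | hyper W U) f W U = #|meet_line X Y| * q ^ (d - 1))%N.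
  rewrite -sum_nat_const (bigID (meet_line X Y)) /= [X in (_ + X)%N]big1 ?addn0; last first.
    move=> W /andP[_ nW]; rewrite big1 // => U _.
    by rewrite /f (negPf (nW : ~~ meet_line X Y W)).
  apply: eq_big => [W|W /andP[gW AW]]; first by rewrite !inE; case: (gen W).
  have /andP[_ /andP[_ /eqP d1]] := AW.
  have := card_hyper_nge gW (sub0v W) (capvSl W X).
  rewrite add0v dimv0 subn0 d1.
  have -> : qint q d = (qint q (d - 1) + q ^ (d - 1))%N.
    by rewrite -qintS; congr (qint _ _); lia.
  rewrite addKn.
  move=> <-; rewrite -sum1_card -big_mkcondr; apply: eq_bigl => U.
  rewrite [RHS]inE sub0v; congr (_ && _).
  by rewrite -/(meet_line X Y W) (AW : meet_line X Y W = true).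
have gsum : (\sum_(W | gen W) \sum_(U | hyper W U) g W U <= #|gen| * q ^ (d - 1))%N.
  rewrite -sum_nat_const; apply: leq_sum => W gW.
  have [dW|dW] := eqVneq (\dim (W :&: X)) 0%N; last first.
    by rewrite big1 // => U _; rewrite /g (negPf dW) mul0n.
  rewrite (eq_bigr (fun U => \sum_(x | D x && (x \in perp U)) 1)%N); last first.
    by move=> U _; rewrite /g dW eqxx mul1n sum1_card.
  rewrite (exchange_big_dep D) /=; last by move=> U x _ /andP[].
  apply: (@leq_trans (\sum_(x | D x) 1)); last first.
    rewrite sum1_card; apply: (@leq_trans #|(X :&: Y)%VS|).
      by apply: subset_leq_card; apply/subsetP => x /andP[].
    rewrite card_vs leq_exp2l //.
    (* Distinctness of X and Y makes X :&: Y of dimension at most d - 1. The at most q^(d - 1)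
       vectors x are thus balanced by the factor q^(d - 1) in [fsum], and q - 1 is gained. *)
    have := dim_cap_le Y gX; rewrite leq_eqVlt => /orP[/eqP dXY|]; last by lia.
    case/eqP: neXY; have XY : (X :&: Y = X)%VS.
      by apply/eqP; rewrite eqEdim capvSl dXY (gen_dim gX) /=.
    by apply/eqP; rewrite eqEdim -{1}XY capvSr (gen_dim gX) (gen_dim gY) /=.
  apply: leq_sum => x Dx; rewrite sum1_card; have /andP[xXY x0] := Dx.
  have xX : x \in X by move: xXY; rewrite memv_cap => /andP[].
  have sx := tsing_psing (gen_tsing gX) xX.
  have H U : hyper W U -> x \in perp U -> U = (W :&: perp <[x]>)%VS.
    move=> /andP[UW /eqP dUW] xU; apply/eqP; rewrite eqEdim subv_cap UW.
    rewrite sub_perpC -memvE xU /= -ltnS dUW ltn_neqAle dimvS ?capvSl // andbT.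
    apply/negP => /eqP E; have WX : (W :&: perp <[x]> = W)%VS.
      by apply/eqP; rewrite eqEdim capvSl E /=.
    have xW : x \in W.
      apply: (gen_absorb rkP d_gt0 gW sx); rewrite memvE sub_perpC -WX; exact: capvSr.
    move/eqP: dW; rewrite dimv_eq0 => /eqP W0.
    by move: x0; rewrite -memv0 -W0 memv_cap xW xX.
  apply: (@leq_trans #|pred1 (W :&: perp <[x]>)%VS|); last by rewrite card1.
  apply: subset_leq_card.
  by apply/subsetP => U; rewrite !inE => /andP[hU /andP[_ xU]]; apply/eqP/H.
have fg : (s * q.-1 * (\sum_(W | gen W) \sum_(U | hyper W U) f W U)
           <= \sum_(W | gen W) \sum_(U | hyper W U) g W U)%N.
  rewrite !(flag_sum) big_distrr /=; apply: leq_sum => U pU.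
  have gg := gate_gen rkP d_gt0 pU gX; have gs := gate_sub P U X.
  have gE := gateE rkP d_gt0 pU gX.
  have cp := card_pencil rkP d_gt0 pU.
  rewrite (cardD1 (gate P U X)) inE gg gs add1n in cp; case: cp => cp.
  have ggU : ~~ (gate P U X :&: X <= U)%VS by rewrite -gE.
  rewrite (bigD1 (gate P U X)) ?inE ?gg ?gs //= big1 ?addn0; last first.
    move=> W; rewrite inE -andbA => /and3P[gW UW].
    by rewrite gE // negbK /f => ->; rewrite andbF.
  rewrite [f _ _]/f ggU andbT; case AG: (meet_line X Y _); last by rewrite muln0.
  have /andP[_ /andP[/eqP GXY dG]] := AG.
  have dUX : \dim (U :&: X) = 0%N by move: dG; rewrite (dim_gate rkP d_gt0 pU gX) => /eqP[].
  rewrite muln1 -cp -sum_nat_const.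
  rewrite [leqRHS](bigD1 (gate P U X)) ?inE ?gg ?gs //=; apply: leq_trans (leq_addl _ _).
  rewrite [leqRHS](eq_bigl (mem [predD1 pencil U & gate P U X])); last first.
    by move=> W; rewrite !inE andbC.
  apply: leq_sum => W /andP[ne /andP[gW UW]].
  rewrite /g (nongate_cap rkP d_gt0 pU gX gW UW ne) dUX mul1n.
  have : #|(gate P U X :&: X)%VS| = q by rewrite card_vs (eqP dG) expn1.
  rewrite (cardD1 0) mem0v add1n => <- /=; apply: subset_leq_card.
  apply/subsetP => x; rewrite !inE => /andP[-> xG].
  have := xG; rewrite {1}GXY !memv_cap => /andP[xg xY].
  have xX : x \in X by move: xG; rewrite memv_cap => /andP[].
  by rewrite xX xY (pencil_perp gg gs).
have a0 : (0 < q ^ (d - 1))%N by rewrite expn_gt0; lia.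
by rewrite -(leq_pmul2r a0) -mulnA -fsum; apply: leq_trans gsum.
Qed.

Definition meet_both X Y := [pred W | gen W &&
  ((0 < \dim (W :&: X)) && (0 < \dim (W :&: Y)))%N].

(** The split follows how W :&: X and W :&: Y compare: one fails to lie in the other, or they are
    equal of dimension 1, or equal of dimension at least 2. Each class is rarer than the generators
    meeting a single X, by a factor of order 1/s or 1/q. *)
Lemma card_meet_both X Y : gen X -> gen Y -> X != Y ->
  (#|meet_both X Y| <= #|meet_nsub X Y| + #|meet_nsub Y X|
     + #|meet_line X Y| + nmeet_ge X 2)%N.
Proof.
move=> gX gY neXY.
pose B := [pred W | gen W && (2 <= \dim (W :&: X))%N].
have : meet_both X Y \subset [predU [predU [predU meet_nsub X Y & meet_nsub Y X] & meet_line X Y] & B].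
  apply/subsetP => W; rewrite !inE => /andP[-> /andP[dX dY]] /=; rewrite dX dY /=.
  rewrite [(W :&: X)%VS == _]eqEsubv.
  case: (W :&: X <= W :&: Y)%VS => //=; case: (W :&: Y <= W :&: X)%VS => //=.
  lia.
move/subset_leq_card/leq_trans; apply.
have cU (A1 A2 : pred {vspace V}) : (#|[predU A1 & A2]| <= #|A1| + #|A2|)%N.
  by rewrite -cardUI leq_addr.
apply: leq_trans (cU _ _) _; rewrite leq_add2r.
apply: leq_trans (cU _ _) _; rewrite leq_add2r.
exact: cU.
Qed.

Definition blind X Y U := [forall Z in pencil U, \dim (Z :&: X) == \dim (Z :&: Y)].

(** If the gates differed, the gate of X would force dim (U :&: Y) = dim (U :&: X) + 1, and the gate
    of Y the same with X and Y exchanged. *)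
Lemma blind_gate X Y U : gen X -> gen Y -> panel U -> blind X Y U ->
  gate P U X = gate P U Y.
Proof.
move=> gX gY pU /forall_inP bl; apply/eqP/contraT => ne.
have ggX := gate_gen rkP d_gt0 pU gX; have gsX := gate_sub P U X.
have ggY := gate_gen rkP d_gt0 pU gY; have gsY := gate_sub P U Y.
have /eqP : \dim (gate P U X :&: X) == \dim (gate P U X :&: Y).
  by apply: bl; rewrite inE ggX.
have /eqP : \dim (gate P U Y :&: X) == \dim (gate P U Y :&: Y).
  by apply: bl; rewrite inE ggY.
rewrite (dim_gate rkP d_gt0 pU gX) (dim_gate rkP d_gt0 pU gY).
rewrite (nongate_cap rkP d_gt0 pU gY ggX gsX ne).
rewrite (nongate_cap rkP d_gt0 pU gX ggY gsY) 1?eq_sym //; lia.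
Qed.

Lemma card_blind X Y : gen X -> gen Y ->
  (#|[pred U | panel U && blind X Y U]| <= #|meet_both X Y| * qint q d)%N.
Proof.
move=> gX gY.
rewrite -sum_nat_const.
have := flag_sum (fun W U => meet_both X Y W : nat).
rewrite (eq_bigr (fun W => (meet_both X Y W * qint q d)%N)); last first.
  by move=> W gW; rewrite sum_nat_const -(card_hyperT gW) mulnC.
move=> E; have -> : (\sum_(W in meet_both X Y) qint q d
   = \sum_(W | gen W) meet_both X Y W * qint q d)%N.
  rewrite big_mkcond [RHS]big_mkcond; apply: eq_bigr => W _; rewrite !inE.
  by case: (gen W) => //=; case: (_ && _); rewrite ?mul1n.
rewrite E -sum1_card big_mkcondr; apply: leq_sum => U pU.
case: ifP => // bl; have gg := gate_gen rkP d_gt0 pU gX; have gs := gate_sub P U X.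
rewrite (bigD1 (gate P U X)) ?inE ?gg ?gs //= (dim_gate rkP d_gt0 pU gX).
by rewrite (blind_gate gX gY pU bl) (dim_gate rkP d_gt0 pU gY).
Qed.

End DualPolar.

(** * From reflexive and quadratic forms to polarities *)

Section HermitianTrace.
Variables (F : finFieldType) (theta : {rmorphism F -> F}).
Hypotheses (thetaK : involutive theta) (theta_nid : ~ (theta =1 id)).
Local Notation fixed := [pred a | theta a == a].

Lemma moved_ex : exists z, theta z != z.
Proof.
apply/existsP; rewrite -[[exists x, _]]negbK; apply/negP; rewrite negb_exists.
move/forallP=> H; apply: theta_nid => x; apply/eqP; move: (H x); by rewrite negbK.
Qed.

Lemma card_fixed : (#|fixed| ^ 2)%N = #|F|.
Proof.
(* 1 and z form a basis of F over the fixed field. *)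
have [z zP] := moved_ex.
have zB : z - theta z != 0 by rewrite subr_eq0 eq_sym.
pose h (p : F * F) := p.1 + p.2 * z.
have injh : {in [pred p : F * F | fixed p.1 && fixed p.2] &, injective h}.
  move=> [a b] [a' b']; rewrite !inE /= => /andP[/eqP fa /eqP fb] /andP[/eqP fa' /eqP fb'].
  rewrite /h /= => E.
  have E2 : a + b * theta z = a' + b' * theta z.
    by rewrite -{1}fa -{1}fb -[in RHS]fa' -[in RHS]fb' -!rmorphM -!rmorphD E.
  have : (b - b') * (z - theta z) = 0.
    have -> : (b - b') * (z - theta z) = (a + b * z) - (a' + b' * z) - ((a + b * theta z) - (a' + b' * theta z)).
      by ring.
    by rewrite E E2 !subrr.
  move/eqP; rewrite mulf_eq0 (negPf zB) orbF subr_eq0 => /eqP bb.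
  by move: E; rewrite bb => /addIr ->.
rewrite -mulnn -cardX -(card_in_image (f := h) (A := [pred p : F * F | fixed p.1 && fixed p.2])) //.
apply: eq_card => x; rewrite [RHS]inE; apply/imageP.
pose b := (x - theta x) / (z - theta z).
have fb : theta b = b.
  rewrite /b fmorph_div !rmorphB !thetaK -[theta x - x]opprB -[theta z - z]opprB.
  by rewrite invrN mulrNN.
exists (x - b * z, b); last by rewrite /h /= subrK.
rewrite !inE /= fb eqxx andbT rmorphB rmorphM fb.
rewrite -subr_eq0.
have -> : theta x - b * theta z - (x - b * z) = b * (z - theta z) - (x - theta x) by ring.
by rewrite /b divfK // subrr.
Qed.

(** The element 1 serves unless the characteristic is 2; then z + theta z = z - theta z, which is
    nonzero for a moved z. *)
Lemma trace_nz_ex : exists t, t + theta t != 0.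
Proof.
have [z zP] := moved_ex; have [E|] := eqVneq (1 + theta 1) 0; last by exists 1.
exists z; rewrite addrC; apply: contra zP; rewrite addr_eq0 => /eqP->.
move: E; rewrite rmorph1 => E; rewrite -subr_eq0 -opprD oppr_eq0 -[z]mul1r -mulrDl E.
by rewrite mul0r.
Qed.

(** All fibres of the trace over the fixed field are translates of its kernel, so each has #|F| /
    #|fixed| elements, and [card_fixed] evaluates this quotient. The lemma supplies [psecant] for
    Hermitian forms. *)
Lemma card_trace_fiber c : theta c = c ->
  #|[pred z | z + theta z == c]| = #|fixed|.
Proof.
have [t tP] := trace_nz_ex; pose T z := z + theta z.
have fT z : theta (T z) = T z by rewrite /T rmorphD thetaK addrC.
pose K := #|[pred z | T z == 0]|.
have fibE c' : theta c' = c' -> #|[pred z | T z == c']| = K.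
  move=> fc; pose w := c' / T t * t.
  have Tw : T w = c'.
    rewrite /T /w !rmorphM fmorphV fT fc -mulrDr -/(T t) divfK //.
  rewrite /K -!sum1_card (reindex_inj (addIr w)) /=; apply: eq_bigl => z.
  rewrite !inE /T rmorphD addrACA -/(T z) -/(T w) Tw.
  by rewrite -subr_eq0 addrK.
have cF : #|F| = (#|fixed| * K)%N.
  rewrite -sum1_card (partition_big T fixed) /=; last by move=> z _; rewrite fT.
  rewrite -sum_nat_const; apply: eq_bigr => c' /eqP fc; rewrite -(fibE c') // -sum1_card.
  by apply: eq_bigl.
move=> fc; rewrite fibE //; have := card_fixed; rewrite -mulnn cF => /eqP.
rewrite eqn_pmul2l => [/eqP//|].
by apply/card_gt0P; exists 0; rewrite !inE rmorph0.
Qed.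

End HermitianTrace.

Lemma polarity_of_form (F : finFieldType) (n : nat) (k : form_kind)
    (f : nondegenerate_form 'rV[F]_n k) :
  exists2 P : polarity F n, (forall X, singular f X = tsing P X) &
    match k with
    | Alternating => psecant P = #|F|
    | Defs.Hermitian => (psecant P ^ 2 = #|F|)%N
    | Quadratic => psecant P = 1%N
    end.
Proof.
have nondegP eps (theta : {rmorphism F -> F}) (b : {hermitian 'rV[F]_n for eps & theta}) :
    nondegenerate b -> forall x, (forall y, b x y = 0) -> x = 0.
  move=> /eqP rad0 x bx; apply/eqP; rewrite -memv0 -rad0.
  by apply/mem_orthovP => y _; apply: bx.
have singE (b : 'rV[F]_n -> 'rV[F]_n -> F) (P : polarity F n) (X : {vspace 'rV[F]_n}) :
    pform P = b -> (X <= perp P X)%VS = [forall x in X, forall y in X, b x y == 0].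
  move=> <-; apply/subvP/forall_inP => [XX x xX|XX x xX].
    by apply/forall_inP; apply/perpP/XX.
  by apply/perpP/forall_inP/XX.
case: f => [b nd alt|theta b thK thn nd|Q nd].
- have plin y : scalar (b^~ y) by move=> a u v; rewrite linearPl.
  have psym x y : b x y = 0 -> b y x = 0.
    by move=> /eqP; rewrite herm_eq0C => /eqP.
  have sec x y : predT x -> b x y != 0 -> #|[pred a : F | predT (y + a *: x)]| = #|F|.
    by move=> _ _; apply: eq_card => a; rewrite !inE.
  exists (@Polarity F n b predT plin psym isT (fun x _ => alt x)
    (fun _ _ _ _ _ _ => isT) (fun x _ => nondegP _ _ b nd x) _ sec) => // X.
  rewrite /= /tsing (singE b) //=; apply/esym/andb_idr => _.
  by apply/forall_inP.
- have plin y : scalar (b^~ y) by move=> a u v; rewrite linearPl.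
  have bC x y : b x y = theta (b y x) by rewrite hermC expr0 mul1r.
  have psym x y : b x y = 0 -> b y x = 0.
    by move=> /eqP; rewrite herm_eq0C => /eqP.
  have ps0 : b 0 0 == 0 by rewrite linear0l.
  have bZ x y a : b x (a *: y) = theta a * b x y by rewrite linearZr_LR.
  have bZl x y a : b (a *: x) y = a * b x y by rewrite linearZl_LR.
  have bD x y z w : b (x + y) (z + w) = b x z + b x w + (b y z + b y w).
    by rewrite linearDl !linearDr.
  have pcomb a x y : b x x == 0 -> b y y == 0 -> b x y = 0 -> b (a *: x + y) (a *: x + y) == 0.
    move=> /eqP xx /eqP yy xy; have yx := psym _ _ xy.
    by rewrite bD !bZ !bZl xx yy xy yx !mulr0 !addr0.
  (* For isotropic x, b (y + a x) (y + a x) is b y y plus the trace of a * b x y, so the solutions a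
     correspond to the trace fibre over - b y y. *)
  have sec x y : b x x == 0 -> b x y != 0 ->
      #|[pred a : F | b (y + a *: x) (y + a *: x) == 0]| = #|[pred a | theta a == a]|.
    move=> /eqP xx xy.
    rewrite -(card_trace_fiber thK thn (c := - b y y)); last by rewrite rmorphN -bC.
    rewrite -!sum1_card [RHS](reindex_inj (mulIf xy)) /=; apply: eq_bigl => a.
    rewrite !inE bD !bZ !bZl xx !mulr0 addr0.
    by rewrite rmorphM /= -(bC y x) -addr_eq0; congr (_ == 0); ring.
  exists (@Polarity F n b (fun x => b x x == 0) plin psym ps0 (fun x => eqP)
    pcomb (fun x _ => nondegP _ _ b nd x) _ sec) => [X|] /=; last exact: card_fixed.
  rewrite /tsing (singE b) //=; apply/esym/andb_idr => /forall_inP H.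
  by apply/forall_inP => x xX; move/forall_inP: (H x xX); apply.
- have Qr := qf_polar_r Q; have Ql := qf_polar_l Q.
  have Q0 : Q 0 = 0 by have := qf_scale Q 0 0; rewrite scale0r expr2 !mul0r.
  have pC x y : polar Q x y = polar Q y x by rewrite /polar [y + x]addrC; ring.
  have QD x y : Q (x + y) = polar Q x y + Q x + Q y by rewrite /polar; ring.
  have psym x y : polar Q x y = 0 -> polar Q y x = 0 by rewrite pC.
  have pself x : Q x == 0 -> polar Q x x = 0.
    move=> /eqP x0; rewrite /polar -{1}[x]scale1r -[X in Q (_ + X)]scale1r -scalerDl.
    by rewrite qf_scale x0 mulr0 !subr0.
  have pZ a x y : polar Q (a *: x) y = a * polar Q x y.
    have := Ql y a x 0; rewrite addr0 => ->.
    by rewrite {2}/polar add0r Q0 subr0 subrr addr0.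
  have pcomb a x y : Q x == 0 -> Q y == 0 -> polar Q x y = 0 -> Q (a *: x + y) == 0.
    by move=> /eqP x0 /eqP y0 xy; rewrite QD qf_scale x0 y0 pZ xy !mulr0 !addr0.
  have ps0 : Q 0 == 0 by rewrite Q0.
  have pnd x : Q x == 0 -> (forall y, polar Q x y = 0) -> x = 0.
    by move=> x0 xr; apply/eqP; apply: contraTT x0 => nx; apply: nd.
  have sec x y : Q x == 0 -> polar Q x y != 0 -> #|[pred a : F | Q (y + a *: x) == 0]| = 1%N.
    move=> /eqP x0 xy; transitivity #|pred1 (- Q y / polar Q x y)|; last by rewrite card1.
    apply: eq_card => a.
    rewrite !inE addrC QD qf_scale x0 mulr0 addr0 pZ addr_eq0.
    by rewrite -[RHS](inj_eq (mulIf xy)) divfK.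
  exists (@Polarity F n (polar Q) (fun x => Q x == 0) Ql psym ps0 pself pcomb pnd _ sec) => // X.
  rewrite /= /tsing (singE (polar Q)) //=; apply/esym/andb_idl => /forall_inP H.
  apply/forall_inP => x xX; apply/forall_inP => y yX.
  by rewrite /polar (eqP (H x xX)) (eqP (H y yX)) (eqP (H _ (rpredD xX yX))) !subr0.
Qed.

(** * Dual polar graphs *)

(** The search in [gdist] stops below #|T|. A walk shortened to a duplicate-free path has fewer than
    #|T| edges, and by minimality at least k, so the search does reach k. *)
Lemma gdist_shortest (T : finType) (e : rel T) (x y : T) (k : nat) :
  walkb e k x y -> (forall j, walkb e j x y -> (k <= j)%N) -> gdist e x y = k.
Proof.
move=> wk kmin; have k_lt : (k < #|T|)%N.
  have /existsP[p /andP[ep /eqP lp]] := wk; move: lp.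
  have [p' ep' up' _ lp'] := shortenP ep.
  have /kmin : walkb e (size p') x y.
    by apply/existsP; exists (in_tuple p'); rewrite /= ep' lp' eqxx.
  by move/leq_ltn_trans; apply; rewrite -[_.+1]/(size (x :: p')) -(card_uniqP up') max_card.
apply/eqP; rewrite eqn_leq /gdist; set a := fun m => walkb e m x y.
have ka : has a (iota 0 #|T|).
  by apply/hasP; exists k => //; rewrite mem_iota add0n.
apply/andP; split.
  rewrite leqNgt; apply/negP => kf; have := before_find 0%N kf.
  by rewrite nth_iota // add0n /a wk.
apply: kmin; have := nth_find 0%N ka; rewrite nth_iota ?add0n //.
by rewrite -{2}(size_iota 0 #|T|) -has_find.
Qed.

(* Twice the parameter e, which can be a half-integer. *)
Definition type_param2 (t : polar_type) : nat :=
  match t with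
  | TypeW | TypeQ => 2
  | TypeQplus => 0
  | TypeQminus => 4
  | TypeHodd => 1
  | TypeHeven => 3
  end.

(** Squaring avoids half-integral exponents: [psecant] contributes 2, 1 or 0 to the exponent of q in
    the alternating, Hermitian and quadratic cases, and q^(n - 2d) contributes 2 (n - 2d). *)
Lemma card_pencil_type t d (F : finFieldType) (P : polarity F (type_dim t d)) :
  match type_kind t with
  | Alternating => psecant P = #|F|
  | Defs.Hermitian => (psecant P ^ 2 = #|F|)%N
  | Quadratic => psecant P = 1%N
  end ->
  (pencil_order P d ^ 2 = #|F| ^ type_param2 t)%N.
Proof.
rewrite /pencil_order; case: t P => P /= secE.
- by rewrite subnn expn0 muln1 secE.
- by rewrite secE subSnn mul1n expn1.
- by rewrite secE subnn.
- by rewrite secE -addn2 addKn mul1n -expnM.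
- by rewrite subnn expn0 muln1 secE expn1.
- by rewrite subSnn expn1 expnMn secE -expnS.
Qed.

Section Glue.
Variables (t : polar_type) (d : nat) (F : finFieldType) (PS : polar_space t d F).
Hypothesis d_gt0 : (0 < d)%N.
Variable P : polarity F (type_dim t d).
Hypothesis singE : forall X, singular (ps_form PS) X = tsing P X.
Local Notation T := (dual_polar_vertex PS).
Local Notation V := 'rV[F]_(type_dim t d).
Implicit Types X Y Z : T.

Lemma ps_has_rank : has_rank P d.
Proof.
split=> [X|].
  rewrite -singE => sX; apply: leq_trans (eq_leq (ps_rank PS)).
  by rewrite /form_rank (bigD1 X) //= leq_maxl.
have t0 : tsing P 0.
  apply/tsingP; split; first exact: sub0v.
  by move=> x; rewrite memv0 => /eqP->; apply: psing0.
have [|X sX dX] := @eq_bigmax_cond _ (fun X : {vspace V} => singular (ps_form PS) X) (fun X : {vspace V} => \dim X).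
  by apply/card_gt0P; exists 0%VS; rewrite unfold_in singE.
exists X; first by rewrite -singE.
by have := ps_rank PS; rewrite /form_rank dX.
Qed.
Let rkP := ps_has_rank.

Lemma generatorE (X : {vspace V}) : generator (ps_form PS) X = gen P d X.
Proof.
rewrite /generator singE; apply/andP/idP => [[tX /forallP mX]|gX].
  apply/(gen_maximal rkP d_gt0); split=> // Y tY XY; apply/eqP.
  by have := mX Y; rewrite singE tY XY.
have /(gen_maximal rkP d_gt0)[tX mX] := gX; split=> //.
by apply/forallP => Y; apply/implyP; rewrite singE => /andP[tY XY]; apply/eqP/mX.
Qed.

Lemma vertex_gen X : gen P d (val X).
Proof. by rewrite -generatorE; apply: valP. Qed.

Lemma vertex_ex (Z : {vspace V}) : gen P d Z -> exists X : T, val X = Z.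
Proof. by rewrite -generatorE => gZ; exists (Sub Z gZ); rewrite SubK. Qed.

Lemma card_vertex (A : pred {vspace V}) :
  #|[pred X : T | A (val X)]| = #|[pred Z | gen P d Z && A Z]|.
Proof.
rewrite -(card_image val_inj); apply: eq_card => Z; rewrite !inE.
apply/imageP/andP => [[X AX ->]|[gZ AZ]]; first by rewrite vertex_gen.
by have [X EX] := vertex_ex gZ; exists X; rewrite ?inE EX.
Qed.

(** Along an edge the dimension of the intersection with Y changes by at most one, so no walk is
    shorter. Conversely, a panel of Y containing X :&: Y has a gate towards X that is adjacent to Y
    and meets X in one dimension more than Y does. *)
Lemma gdist_dual_polar X Y :
  gdist (dual_polar_adj PS) X Y = (d - \dim (val X :&: val Y))%N.
Proof.
have cap_le Z : (\dim (val X :&: val Z) <= d)%N := dim_cap_le (val Z) (vertex_gen X).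
apply: gdist_shortest; last first.
  move=> j /existsP[p /andP[ep /eqP lp]]; rewrite -(size_tuple p).
  elim: {p}(val p) X ep lp {cap_le} => [|Z p IHp] X /= => [_ ->|/andP[/eqP XZ ep] lp].
    by rewrite capvv (gen_dim (vertex_gen Y)) subnn.
  have := IHp Z ep lp.
  have : (\dim (val Z :&: val Y) <= (\dim (val X :&: val Y)).+1)%N.
    have := dimv_sum_cap (val X :&: val Z)%VS (val Z :&: val Y)%VS.
    have : (\dim ((val X :&: val Z) + (val Z :&: val Y)) <= d)%N.
      apply: leq_trans (eq_leq (gen_dim (vertex_gen Z))); apply: dimvS.
      by rewrite subv_add capvSr capvSl.
    have : (\dim ((val X :&: val Z) :&: (val Z :&: val Y)) <= \dim (val X :&: val Y))%N.
      by apply/dimvS/subvP => v; rewrite !memv_cap => /andP[/andP[-> _] /andP[_ ->]].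
    rewrite XZ; lia.
  move=> stepZ; rewrite !leq_subLR => /leq_trans; apply.
  by rewrite addnS -addSn leq_add2r.
move Ek : (d - _)%N => k; elim: k Y Ek => [|k IHk] Y Ek.
  have <- : X = Y.
    apply/val_inj/eqP; rewrite eqEdim (gen_dim (vertex_gen X)) (gen_dim (vertex_gen Y)) leqnn andbT.
    have XY : (val X :&: val Y = val X)%VS.
      by apply/eqP; rewrite eqEdim capvSl (gen_dim (vertex_gen X)) -subn_eq0 Ek.
    by rewrite -XY capvSr.
  by apply/existsP; exists [tuple]; rewrite /= eqxx.
have := card_hyper_ge (vertex_gen Y) (capvSl (val Y) (val X)).
have -> : (d - \dim (val Y :&: val X) = k.+1)%N by rewrite capvC.
move=> cardU; have : (0 < qint #|F| k.+1)%N by apply: qint_gt0.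
rewrite -cardU => /card_gt0P[U]; rewrite inE => /andP[hU YXU].
have pU := hyper_panel (vertex_gen Y) hU.
have [Z EZ] := vertex_ex (gate_gen rkP d_gt0 pU (vertex_gen X)).
have UY : (U <= val Y)%VS by case/andP: hU.
have UX : (U :&: val X = val Y :&: val X)%VS.
  by apply/eqP; rewrite eqEsubv !subv_cap YXU !capvSr (subv_trans (capvSl _ _) UY).
have dZX := dim_gate rkP d_gt0 pU (vertex_gen X); rewrite -EZ UX in dZX.
have /existsP[p /andP[ep /eqP lp]] : walkb (dual_polar_adj PS) k X Z.
  by apply: IHk; rewrite capvC dZX capvC; lia.
apply/existsP; exists [tuple of rcons p Y]; rewrite /= rcons_path last_rcons eqxx andbT.
rewrite ep lp /dual_polar_adj /=; apply/eqP.
have dU : \dim U = d.-1 by case/andP: pU => _ /eqP.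
apply/eqP; rewrite eqn_leq; apply/andP; split; last first.
  by rewrite -dU; apply: dimvS; rewrite subv_cap UY EZ gate_sub.
rewrite -ltnS prednK // ltn_neqAle (dim_cap_le _ (vertex_gen Z)) andbT.
apply/negP => /eqP dZY; have ZY : val Z = val Y.
  have ZYZ : (val Z :&: val Y = val Z)%VS.
    by apply/eqP; rewrite eqEdim capvSl dZY (gen_dim (vertex_gen Z)) /=.
  apply/eqP; rewrite eqEdim (gen_dim (vertex_gen Z)) (gen_dim (vertex_gen Y)) leqnn andbT.
  by rewrite -ZYZ capvSr.
by move: dZX; rewrite ZY; lia.
Qed.

Lemma dual_polar_vertex_gt0 : (0 < #|T|)%N.
Proof.
have [Z0 tZ0 _] := (ps_has_rank).2.
have [Z gZ _] := gen_above rkP d_gt0 tZ0.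
by have [X _] := vertex_ex gZ; apply/card_gt0P; exists X.
Qed.

End Glue.

(** Three of the four classes of [card_meet_both] have constant 2 and give 6 q; [meet_line] gives s
    - 2; and [card_flags] converts generators into panels at the price of s + 1. For s < 3 truncated
    subtraction makes the left side 0. *)
Lemma card_blind_le (F : finFieldType) n (P : polarity F n) d (X Y : {vspace 'rV[F]_n}) :
  has_rank P d -> (0 < d)%N -> gen P d X -> gen P d Y -> X != Y ->
  (#|[pred U | panel P d U && blind P d X Y U]|
     * (pencil_order P d * (pencil_order P d - 2) * #|F|.-1)
   <= (6 * #|F| + pencil_order P d - 2) * (pencil_order P d).+1 * #|panel P d|)%N.
Proof.
move=> rkP d0 gX gY neXY; set q := #|F|; set s := pencil_order P d.
have hb := card_blind rkP d0 gX gY; have hM := card_meet_both d0 gX gY neXY.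
have a1 := card_meet_nsub rkP d0 gX gY; have a2 := card_meet_nsub rkP d0 gY gX.
have a3 := card_meet_line rkP d0 gX gY neXY.
have a4 := nmeet_ge_half rkP d0 gX (leqnn 1).
have nX := nmeet_ge1_le rkP d0 gX; have nY := nmeet_ge1_le rkP d0 gY.
have fl := card_flags rkP d0.
have N0 : (0 < #|gen P d|)%N by apply/card_gt0P; exists X.
move: hb hM a1 a2 a3 a4 nX nY fl N0; rewrite -/q -/s.
set B := #|[pred U | _ && _]|; set M := #|meet_both _ _ _ _|; set N := #|gen P d|.
set p := #|panel P d|; set m1 := #|meet_nsub _ _ X Y|; set m2 := #|meet_nsub _ _ Y X|.
set m3 := #|meet_line _ _ _ _|; set x1 := nmeet_ge _ _ X 1; set x2 := nmeet_ge _ _ X 2.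
set y1 := nmeet_ge _ _ Y 1; set r := qint q d.
move=> hb hM a1 a2 a3 a4 nX nY fl N0.
have [s2|s2] := ltnP s 3.
  have -> : (s - 2 = 0)%N by lia.
  by rewrite muln0 mul0n muln0.
have q0 : (0 < q.-1)%N by have := finNzRing_gt1 F; rewrite -/q; lia.
set w := (s - 2)%N in nX nY *; set u := q.-1 in a3 nX nY q0 *.
have hsM : (s * w * u * M <= (6 * q + w) * N)%N.
  apply: (@leq_trans (s * w * u * (m1 + m2 + m3 + x2))); first by rewrite leq_mul2l hM orbT.
  have h1 : (w * u * (s * m1) <= w * u * (2 * y1))%N by rewrite leq_mul2l a1 orbT.
  have h2 : (w * u * (s * m2) <= w * u * (2 * x1))%N by rewrite leq_mul2l a2 orbT.
  have h3 : (w * (s * u * m3) <= w * N)%N by rewrite leq_mul2l a3 orbT.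
  have h4 : (w * u * (s * x2) <= w * u * (2 * x1))%N by rewrite leq_mul2l a4 orbT.
  have -> : (s * w * u * (m1 + m2 + m3 + x2) = w * u * (s * m1) + w * u * (s * m2) + w * (s * u * m3) + w * u * (s * x2))%N by ring.
  apply: (@leq_trans (w * u * (2 * y1) + w * u * (2 * x1) + w * N + w * u * (2 * x1))); first by lia.
  have -> : (w * u * (2 * y1) = 2 * (y1 * w * u))%N by ring.
  have -> : (w * u * (2 * x1) = 2 * (x1 * w * u))%N by ring.
  by lia.
have -> : (6 * q + s - 2 = 6 * q + w)%N by rewrite /w; lia.
rewrite -(leq_pmul2r N0).
apply: (@leq_trans ((s * w * u * M) * (r * N))).
  have -> : (B * (s * w * u) * N = s * w * u * N * B)%N by ring.
  have -> : (s * w * u * M * (r * N) = s * w * u * N * (M * r))%N by ring.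
  by rewrite leq_mul2l hb orbT.
rewrite (mulnC r) fl.
have -> : ((6 * q + w) * s.+1 * p * N = (6 * q + w) * N * (p * s.+1))%N by ring.
by rewrite leq_mul2r hsM orbT.
Qed.

(** The interface to the asymptotic part: beyond this point the geometry is seen only through these
    counts, with the panels hidden in an arbitrary finite type. *)
Lemma dual_polar_counts t d (F : finFieldType) (PS : polar_space t d F) :
  (0 < d)%N ->
  let T := dual_polar_vertex PS in
  let D := gdist (dual_polar_adj PS) in
  let q := #|F| in
  exists s : nat, [/\ (0 < #|T|)%N /\ (s ^ 2 = q ^ type_param2 t)%N,
    forall X Y, (D X Y <= d)%N,
    forall X, #|[pred Y | D X Y == d]| = (s ^ d * q ^ 'C(d, 2))%N,
    forall X, (#|[pred Y | (D X Y < d)%N]| * (s - 2) * q.-1 <= q * #|T|)%N &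
    exists (B : finType) (panels : pred B) (pencils : B -> {set T}),
    [/\ (0 < #|panels|)%N,
      forall U, panels U -> #|pencils U| = s.+1 &
      forall X Y, X != Y ->
      (#|[pred U | panels U && [forall Z in pencils U, D Z X == D Z Y]]|
          * (s * (s - 2) * q.-1)
        <= (6 * q + s - 2) * s.+1 * #|panels|)%N]].
Proof.
move=> d0 T D q.
have [P singE secE] := polarity_of_form (ps_form PS).
have rkP := ps_has_rank singE; have vg := vertex_gen d0 singE.
have DE X Y : D X Y = (d - \dim (val X :&: val Y))%N := gdist_dual_polar d0 singE X Y.
have dcap (X Y : T) : (\dim (val X :&: val Y) <= d)%N := dim_cap_le (val Y) (vg X).
have cT (A : pred _) : #|[pred X : T | A (val X)]| = #|[pred Z | gen P d Z && A Z]|.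
  exact: card_vertex.
have cTT : #|T| = #|gen P d|.
  transitivity #|[pred X : T | xpredT (val X)]|; first by apply: eq_card => X; rewrite !inE.
  by rewrite (cT xpredT); apply: eq_card => X; rewrite !inE andbT.
exists (pencil_order P d); split.
- by split; [exact: dual_polar_vertex_gt0 singE|exact: card_pencil_type].
- by move=> X Y; rewrite DE leq_subr.
- move=> X; rewrite -(nmeet0 rkP d0 (vg X)) /nmeet -(cT (fun Z => \dim (Z :&: val X)%VS == 0%N)); apply: eq_card => Y.
  by rewrite !inE DE capvC; move: (dcap Y X); move: (\dim _) => k; lia.
- move=> X; have := nmeet_ge1_le rkP d0 (vg X); rewrite cTT.
  have -> // : #|[pred Y | (D X Y < d)%N]| = nmeet_ge P d (val X) 1.
  rewrite /nmeet_ge -(cT (fun Z => 1 <= \dim (Z :&: val X)%VS)%N); apply: eq_card => Y.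
  by rewrite !inE DE capvC; move: (dcap Y X); move: (\dim _) => k; lia.
pose pencils U := [set Z : T | (U <= val Z)%VS].
exists {vspace 'rV[F]_(type_dim t d)}, (panel P d), pencils; split.
- have := dual_polar_vertex_gt0 d0 singE; rewrite cTT => N0.
  have := card_flags rkP d0; rewrite lt0n.
  apply: contra_eqN => /eqP->; rewrite mul0n muln_eq0 negb_or -!lt0n N0.
  by rewrite -(prednK d0) qint_gt0.
- move=> U pU; rewrite -(card_pencil rkP d0 pU) cardsE (cT (fun Z => (U <= Z)%VS)).
  by apply: eq_card => Z; rewrite !inE.
move=> X Y neXY; have := card_blind_le rkP d0 (vg X) (vg Y) neXY.
apply: leq_trans; rewrite leq_mul2r; apply/orP; right; apply: subset_leq_card.
apply/subsetP => U; rewrite !inE => /andP[-> /forall_inP bl] /=.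
apply/forall_inP => Z; rewrite inE => /andP[gZ UZ].
have [Z' EZ] := vertex_ex d0 singE gZ.
have := bl Z'; rewrite inE EZ UZ !DE -EZ => /(_ isT).
move: (dcap Z' X) (dcap Z' Y); move: (\dim _) => i; move: (\dim _) => j.
by move=> ? ? /eqP ?; apply/eqP; lia.
Qed.

(** * Greedy choice of panels by averaging *)

Section Greedy.
Variables (B E : finType) (panels : pred B) (bad : B -> pred E) (a b : nat).
Hypothesis panels_gt0 : (0 < #|panels|)%N.
Hypothesis badP : forall x, (#|[pred U | panels U && bad U x]| * b <= a * #|panels|)%N.

Lemma greedy_step (A : pred E) :
  exists2 U, panels U & (#|[pred x | A x && bad U x]| * b <= a * #|A|)%N.
Proof.
have [U /andP[pU hU]|none] :=
  pickP [pred U | panels U && (#|[pred x | A x && bad U x]| * b <= a * #|A|)%N].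
  by exists U.
have H U : panels U -> (a * #|A| < #|[pred x | A x && bad U x]| * b)%N.
  by move=> pU; have := none U; rewrite /= pU /= ltnNge => ->.
exfalso.
have : (\sum_(U in panels) a * #|A| < \sum_(U in panels) #|[pred x | A x && bad U x]| * b)%N.
  have [U0 U0P] := card_gt0P panels_gt0.
  rewrite (bigD1 U0) //= [ltnRHS](bigD1 U0) //= -addSn leq_add ?H //.
  by apply: leq_sum => U /andP[/H/ltnW].
rewrite ltnNge => /negP; apply; rewrite sum_nat_const -big_distrl /=.
have -> : (\sum_(U in panels) #|[pred x | A x && bad U x]|
    = \sum_(x in A) #|[pred U | panels U && bad U x]|)%N.
  under eq_bigr do rewrite -sum1_card.
  under [RHS]eq_bigr do rewrite -sum1_card.
  rewrite (exchange_big_dep (mem A)) /=; last by move=> U x _ /andP[].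
  apply: eq_bigr => x Ax; apply: eq_bigl => U; rewrite !inE.
  by rewrite (Ax : A x = true).
have -> : (#|panels| * (a * #|A|) = \sum_(x in A) a * #|panels|)%N.
  by rewrite sum_nat_const; ring.
by rewrite big_distrl /=; apply: leq_sum => x _; apply: badP.
Qed.

Lemma greedy k : exists2 us : seq B, all panels us && (size us == k) &
  (#|[pred x | all (bad^~ x) us]| * b ^ k <= a ^ k * #|E|)%N.
Proof.
elim: k => [|k [us /andP[pus /eqP su] IH]].
  by exists [::] => //; rewrite !expn0 muln1 mul1n max_card.
have [U pU hU] := greedy_step [pred x | all (bad^~ x) us].
exists (U :: us); first by rewrite /= pU pus su eqxx.
rewrite !expnS.
apply: (@leq_trans (#|[pred x | all (bad^~ x) us && bad U x]| * b * b ^ k)).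
  rewrite -mulnA leq_mul2r; apply/orP; right; apply: subset_leq_card.
  by apply/subsetP => x; rewrite !inE /= andbC.
apply: leq_trans (leq_mul hU (leqnn _)) _.
by rewrite -!mulnA leq_mul2l IH orbT.
Qed.
End Greedy.

(** * Resolving sets as unions of pencils *)

Section MetricDim.
Variables (T : finType) (e : rel T).

Lemma gdistxx (x : T) : gdist e x x = 0%N.
Proof.
apply: gdist_shortest => //; apply/existsP; exists [tuple]; by rewrite /= eqxx.
Qed.

Lemma gdist_eq0 (x y : T) : gdist e x y = 0%N -> x = y.
Proof.
rewrite /gdist; case E: (iota 0 #|T|) => [|m ms] /=.
  have := fintype0 x; move/(congr1 size): E; rewrite size_iota => -> /(_ erefl) [].
have -> : m = 0%N by have := congr1 (nth 0%N ^~ 0%N) E; rewrite nth_iota // -(size_iota 0 #|T|) E.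
case: ifP => // /existsP[p /andP[_ /eqP <-]] _.
by rewrite (tuple0 p).
Qed.

Lemma resolvingT : resolving e [set: T].
Proof.
apply/forallP => x; apply/forallP => y; apply/implyP => /forall_inP H.
have := H x (in_setT x); rewrite gdistxx eq_sym => /eqP /gdist_eq0 ->; exact: eqxx.
Qed.

Lemma metric_dim_le (S : {set T}) : resolving e S -> (metric_dim e <= #|S|)%N.
Proof. by move=> rS; rewrite /metric_dim; case: arg_minnP => [|S0 _]; [exact: resolvingT|apply]. Qed.

Lemma metric_dim_ex : exists2 S : {set T}, resolving e S & metric_dim e = #|S|.
Proof. by rewrite /metric_dim; case: arg_minnP => [|S0]; [exact: resolvingT|exists S0]. Qed.

Lemma resolvingP (S : {set T}) x y :
  resolving e S -> (forall s, s \in S -> gdist e s x = gdist e s y) -> x = y.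
Proof.
move=> /forallP/(_ x)/forallP/(_ y)/implyP H sxy; apply/eqP/H.
by apply/forall_inP => s /sxy ->.
Qed.

(** Each pencil leaves at most a fraction a/b of the remaining pairs unseparated; the last
    hypothesis makes their final number less than 1, hence 0. *)
Lemma metric_dim_pencils (B : finType) (panels : pred B) (pencils : B -> {set T}) (a b c k : nat) :
  (0 < #|panels|)%N ->
  (forall U, panels U -> #|pencils U| = c) ->
  (forall x y, x != y ->
    (#|[pred U | panels U && [forall z in pencils U, gdist e z x == gdist e z y]]| * b
     <= a * #|panels|)%N) ->
  (a ^ k * #|T| ^ 2 < b ^ k)%N ->
  (metric_dim e <= k * c)%N.
Proof.
move=> p0 cP badP lt_ab.
(* Diagonal pairs are declared never bad, so that the greedy choice can run over the whole of T *
   T. *)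
pose bad U (p : T * T) := (p.1 != p.2) && [forall z in pencils U, gdist e z p.1 == gdist e z p.2].
have bP p : (#|[pred U | panels U && bad U p]| * b <= a * #|panels|)%N.
  have [E|ne] := eqVneq p.1 p.2.
    have -> : #|[pred U | panels U && bad U p]| = 0%N; last by rewrite mul0n.
    by apply: eq_card0 => U; rewrite !inE /bad E eqxx andbF.
  apply: leq_trans (badP _ _ ne); rewrite leq_mul2r; apply/orP; right.
  by apply: subset_leq_card; apply/subsetP => U; rewrite !inE /bad ne.
have [us /andP[pus /eqP su] hus] := greedy p0 bP k.
have no_bad p : ~~ all (bad^~ p) us.
  apply: contraTN lt_ab => bp; rewrite -leqNgt.
  rewrite card_prod -mulnn in hus *; apply: leq_trans hus.
  rewrite -[leqLHS]mul1n leq_mul2r; apply/orP; right; apply/card_gt0P.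
  by exists p.
pose S := \bigcup_(U <- us) pencils U.
have : (#|S| <= k * c)%N.
  rewrite /S -su; elim: (us) pus => [|U vs IHv] /=; first by rewrite big_nil cards0.
  move=> /andP[pU pvs]; rewrite big_cons mulSn.
  apply: (@leq_trans (#|pencils U| + #|\bigcup_(U <- vs) pencils U|)).
    by rewrite cardsU leq_subr.
  by rewrite (cP _ pU) leq_add2l IHv.
apply: leq_trans; apply: metric_dim_le.
apply/forallP => x; apply/forallP => y; apply/implyP => /forall_inP H.
apply/negPn/negP => ne; have /negP := no_bad (x, y); apply.
apply/allP => U Uus; rewrite /bad /= ne /=; apply/forall_inP => z zU; apply: H.
by rewrite /S (big_rem U) //= inE zU.
Qed.

End MetricDim.

(** * Entropy and asymptotics *)

From mathcomp Require Import lra.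
From mathcomp Require Import all_classical all_reals all_analysis.

Import Order.TTheory GRing.Theory Num.Theory.
Import numFieldNormedType.Exports.
Local Open Scope classical_set_scope.
Local Open Scope ring_scope.

Section Entropy.
Variables (R : realType) (T : finType) (D : T -> T -> nat) (d : nat).
Hypothesis D_le : forall x y, (D x y <= d)%N.

(** The distance vectors of distinct points of A are distinct atoms of the product measure with
    marginal [r]. The set A is general because, once the distance to the first landmark is fixed,
    the remaining landmarks need only separate one part of A. *)
Lemma kraft (r : nat -> R) (L : seq T) (A : pred T) :
  (forall j, 0 <= r j) -> \sum_(j < d.+1) r j = 1 ->
  (forall x y, A x -> A y -> (forall s, s \in L -> D s x = D s y) -> x = y) ->
  \sum_(x | A x) \prod_(s <- L) r (D s x) <= 1.
Proof.
move=> r0 r1; elim: L A => [|s L IHL] A sep.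
  under eq_bigr do rewrite big_nil.
  rewrite sumr_const -[leRHS]/(1%:R) ler_nat; apply/card_le1_eqP => x y Ax Ay.
  exact: sep.
rewrite (partition_big (fun x => inord (D s x) : 'I_d.+1) xpredT) //= -[leRHS]r1.
apply: ler_sum => j _.
apply: (@le_trans _ _ (r j * \sum_(x | A x && (D s x == j)) \prod_(u <- L) r (D u x))).
  rewrite mulr_sumr le_eqVlt; apply/orP; left; apply/eqP.
  have E x : (inord (D s x) == j :> 'I_d.+1) = (D s x == j).
    by rewrite -val_eqE /= inordK // ltnS.
  apply: eq_big => [x|x /andP[_]]; first by rewrite E.
  by rewrite E => /eqP Ej; rewrite big_cons Ej.
rewrite -[leRHS]mulr1; apply: ler_wpM2l => //; apply: IHL => x y.
move=> /andP[Ax /eqP Ex] /andP[Ay /eqP Ey] H; apply: sep => // u.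
by rewrite inE => /orP[/eqP->|/H//]; rewrite Ex Ey.
Qed.

(* Gibbs' inequality against the product measure in which
   each coordinate is d with probability 1 - 1/sigma and is otherwise uniform. *)
Lemma entropy_bound (S : {set T}) (sigma p : R) :
  (0 < d)%N -> 2 <= sigma ->
  (forall s, (#|[pred x | (D s x < d)%N]|%:R <= p * #|T|%:R :> R)) ->
  (forall x y, (forall s, s \in S -> D s x = D s y) -> x = y) ->
  (0 < #|T|)%N ->
  ln #|T|%:R <= #|S|%:R * (- ln (1 - sigma^-1) + p * ln (d%:R * sigma)).
Proof.
move=> d0 sg2 pP sep T0.
have sg0 : 0 < sigma by lra.
have is0 : 0 < sigma^-1 by rewrite invr_gt0.
have is1 : sigma^-1 <= 2^-1 by rewrite lef_pV2 // posrE.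
have dR : 0 < d%:R :> R by rewrite ltr0n.
pose r j : R := if j == d then 1 - sigma^-1 else (d%:R * sigma)^-1.
have r_gt0 j : 0 < r j.
  rewrite /r; case: ifP => _; first by lra.
  by rewrite invr_gt0 mulr_gt0.
have r_sum : \sum_(j < d.+1) r j = 1.
  rewrite big_ord_recr /= {2}/r eqxx (eq_bigr (fun=> (d%:R * sigma)^-1)); last first.
    by move=> j _; rewrite /r ltn_eqF.
  rewrite sumr_const card_ord -[X in X + _]mulr_natl; field.
  by rewrite !lt0r_neq0.
pose w x := \prod_(s <- enum S) r (D s x).
have w_gt0 x : 0 < w x by apply: prodr_gt0.
have w_sum : \sum_x w x <= 1.
  apply: kraft => // [j|x y _ _ H]; first exact: ltW.
  by apply: sep => s sS; apply: H; rewrite mem_enum.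
have N0 : 0 < #|T|%:R :> R by rewrite ltr0n.
set N : R := #|T|%:R in N0 pP *.
(* The inequality ln u <= u - 1 is summed over u = N * w x; by [w_sum] the resulting right side is
   at most 0. *)
have gibbs : N * ln N <= \sum_x - ln (w x).
  rewrite sumrN lerNr -subr_ge0 -opprD oppr_ge0.
  apply: (@le_trans _ _ (\sum_x (N * w x - 1))).
    have -> : N * ln N + \sum_x ln (w x) = \sum_x (ln N + ln (w x)).
      by rewrite big_split /= sumr_const -mulr_natl.
    apply: ler_sum => x _; rewrite -lnM ?posrE //.
    have := @le_ln1Dx R (N * w x - 1); rewrite [1 + _]addrC subrK; apply.
    by have := mulr_gt0 N0 (w_gt0 x); lra.
  rewrite sumrB -mulr_sumr sumr_const -[_ *+ _]mulr_natl mulr1 -/N.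
  by rewrite subr_le0 -[leRHS]mulr1 ler_pM2l.
have lnw x : - ln (w x) = \sum_(s in S) - ln (r (D s x)).
  rewrite -big_enum /w; elim: (enum S) => [|s L IHL]; first by rewrite !big_nil ln1 oppr0.
  rewrite !big_cons lnM ?posrE ?prodr_gt0 // opprD IHL //.
rewrite -(ler_pM2l N0); apply: (le_trans gibbs).
under eq_bigr do rewrite lnw.
rewrite exchange_big /= mulrCA [leRHS]mulr_natl.
set K := N * _; have -> : K *+ #|S| = \sum_(s in S) K by rewrite sumr_const.
rewrite /K; apply: ler_sum => s _.
have lnds : 0 <= ln (d%:R * sigma).
  apply: ln_ge0; rewrite -[leLHS]mulr1 ler_pM ?ler1n //; lra.
have l1 : 0 <= - ln (1 - sigma^-1) by rewrite oppr_ge0 ln_le0; lra.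
apply: (@le_trans _ _ (\sum_(x : T) (- ln (1 - sigma^-1) + (D s x < d)%:R * ln (d%:R * sigma)))).
  apply: ler_sum => x _; rewrite /r; have := D_le s x; rewrite leq_eqVlt => /orP[/eqP->|lt].
    by rewrite eqxx ltnn mul0r addr0.
  by rewrite ltn_eqF // lt mul1r lnV ?posrE ?mulr_gt0 // opprK lerDr.
rewrite big_split /= /K mulrDr; apply: lerD.
  by rewrite sumr_const -[leLHS]mulr_natl.
rewrite -mulr_suml mulrA ler_wpM2r // -natr_sum [leRHS]mulrC; apply: le_trans (pP s).
rewrite ler_nat -sum1_card [leqRHS]big_mkcond; apply: leq_sum => x _.
by rewrite inE; case: (D s x < d)%N.
Qed.

End Entropy.

(** * Growth of real powers and of the logarithm *)

Section Growth.
Variable R : realType.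

Lemma powR_nat_gt (g M : R) : 0 < g ->
  exists N : nat, forall n, (N <= n)%N -> M < n%:R `^ g.
Proof.
move=> g0; pose M' := Num.max M 0 + 1.
have M'0 : 0 < M' by rewrite /M' ltr_pwDr // le_max lexx orbT.
have MM' : M < M' by rewrite /M' ltr_pwDr // le_max lexx.
exists (Num.bound (M' `^ g^-1)) => n Nn; apply: (lt_le_trans MM').
have -> : M' = (M' `^ g^-1) `^ g by rewrite -powRrM mulVf ?lt0r_neq0 // powRr1 // ltW.
apply: ge0_ler_powR; rewrite ?nnegrE ?powR_ge0 ?ler0n ?(ltW g0) //.
apply/ltW/(lt_le_trans (archi_boundP (powR_ge0 _ _))); by rewrite ler_nat.
Qed.

Lemma cvg_inv_powR_nat (g : R) : 0 < g -> (n%:R `^ g)^-1 @[n --> \oo] --> (0 : R).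
Proof.
move=> g0.
have pos : \forall n \near \oo, 0 < n%:R `^ g :> R.
  by near=> n; apply: powR_gt0; rewrite ltr0n; near: n; exact: nbhs_infty_gt.
apply: (iffRL (gtr0_cvgV0 pos)); apply/cvgryPge => M; have [N NP] := powR_nat_gt M g0.
by near=> n; apply/ltW/NP; near: n; apply: nbhs_infty_ge.
Unshelve. all: by end_near. Qed.

Lemma cvg_inv_ln_nat : (ln (n%:R : R))^-1 @[n --> \oo] --> (0 : R).
Proof.
have lnP (M : R) : \forall n \near \oo, M <= ln (n%:R : R).
  have [N NP] := powR_nat_gt (expR M) (@ltr01 R).
  near=> n.
  have nN : (N <= n)%N by near: n; apply: nbhs_infty_ge.
  have := NP n nN; rewrite powRr1 // => h.
  by rewrite -[M]expRK ler_ln ?posrE ?expR_gt0 ?ltW // (lt_trans _ h) ?expR_gt0.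
have pos : \forall n \near \oo, 0 < ln (n%:R : R).
  by near=> n; apply: (@lt_le_trans _ _ 1) => //; near: n; apply: lnP.
by apply: (iffRL (gtr0_cvgV0 pos)); apply/cvgryPge.
Unshelve. all: by end_near. Qed.

End Growth.

(** * Real parameters and the explicit lower bound *)

Section Bounds.
Variable R : realType.

Lemma type_param2E t : (type_param2 t)%:R = 2 * type_param R t.
Proof. by case: t => /=; lra. Qed.

Lemma type_param_ge_half t : 0 < type_param R t -> 1 / 2 <= type_param R t.
Proof. by case: t => /=; lra. Qed.

Lemma natr_order t (q s : nat) :
  (s ^ 2 = q ^ type_param2 t)%N -> s%:R = q%:R `^ type_param R t.
Proof.
move=> sq; apply: (@pexpIrn _ 2) => //; rewrite ?nnegrE ?powR_ge0 //.
rewrite -natrX sq natrX -[RHS]powR_mulrn ?powR_ge0 // -powRrM mulrC -type_param2E.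
by rewrite powR_mulrn.
Qed.

(** Every positive type parameter is at least 1/2. This is the source of the thresholds on q: 9 for
    s >= 3, and 36 for s >= 6. *)
Lemma order_ge t (q k : nat) : (1 <= k)%N -> (k ^ 2 <= q)%N -> 0 < type_param R t ->
  k%:R <= q%:R `^ type_param R t :> R.
Proof.
move=> k1 kq /type_param_ge_half e2.
have q1 : 1 <= q%:R :> R by rewrite ler1n; apply: leq_trans kq; rewrite expn_gt0 k1.
apply: (@le_trans _ _ (q%:R `^ (1 / 2))); last exact: ler_powR.
rewrite div1r powR12_sqrt // -[k%:R]ger0_norm // -sqrtr_sqr ler_wsqrtr //.
by rewrite -natrX ler_nat.
Qed.

Lemma natr_opposite t d (q s : nat) : (0 < q)%N ->
  (s ^ 2 = q ^ type_param2 t)%N ->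
  (s ^ d * q ^ 'C(d, 2))%:R = q%:R `^ const_A d (type_param R t) :> R.
Proof.
move=> q0 sq; rewrite natrM !natrX (natr_order sq) /const_A.
rewrite powRD; last by apply/implyP => _; rewrite pnatr_eq0 -lt0n.
by rewrite [d%:R * _]mulrC powRrM !powR_mulrn ?powR_ge0.
Qed.

Lemma metric_dim_lower t d (F : finFieldType) (PS : polar_space t d F) :
  let e := type_param R t in let q := #|F|%:R in
  (0 < d)%N -> 0 < e -> (9 <= #|F|)%N ->
  (q `^ e - 2) * (const_A d e * ln q)
  <= (metric_dim (dual_polar_adj PS))%:R * (1 + q / (q - 1) * (ln d%:R + e * ln q)).
Proof.
move=> e q d0 e0 q9.
have [s [[T0 sq] D_le n0 NO _]] := dual_polar_counts PS d0.
have sE : s%:R = q `^ e :> R := natr_order sq.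
have s3 : 3 <= s%:R :> R by rewrite sE; apply: (@order_ge t #|F| 3).
have s3n : (3 <= s)%N by rewrite -(ler_nat R).
have q9R : 9 <= q by rewrite /q (ler_nat R 9).
have q1 : (1 < #|F|)%N := finNzRing_gt1 F.
set sg : R := s%:R in sE s3; pose p := q / ((q - 1) * (sg - 2)).
set T := dual_polar_vertex PS in T0 D_le n0 NO *.
have pP x : #|[pred Y : T | (gdist (dual_polar_adj PS) x Y < d)%N]|%:R <= p * #|T|%:R :> R.
  have := NO x; rewrite -(ler_nat R) !natrM natrB 1?ltnW // -subn1 natrB 1?ltnW // -/sg -/q.
  move=> h; rewrite /p mulrAC ler_pdivlMr ?mulr_gt0; [|lra..].
  by apply: le_trans h; rewrite mulrA mulrAC.
have [S rS ->] := metric_dim_ex (dual_polar_adj PS).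
have sg2 : 2 <= sg by lra.
(* With sigma = s the distances below d receive total weight 1/s, the order of their true frequency,
   so a landmark costs O(ln q / s). *)
have ent := entropy_bound D_le d0 sg2 pP (fun x y h => resolvingP rS h) T0.
have [x0 _] := card_gt0P T0.
have lnT : const_A d e * ln q <= ln #|T|%:R.
  have q0 : 0 < q by lra.
  have T0R : 0 < #|T|%:R :> R by rewrite ltr0n.
  rewrite -ln_powR ler_ln ?posrE ?powR_gt0 //.
  rewrite -(natr_opposite d _ sq) ?(ltnW q1) // ler_nat -(n0 x0); exact: max_card.
(* The left side is ln (1 + 1/(s - 1)), at most 1/(s - 1); it is weakened to share the denominator s
   - 2 with [p]. *)
have lnp : - ln (1 - sg^-1) <= (sg - 2)^-1.
  rewrite -lnV ?posrE; last by rewrite subr_gt0 invf_lt1; lra.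
  have -> : (1 - sg^-1)^-1 = 1 + (sg - 1)^-1.
    by field; rewrite ?lt0r_neq0 //; lra.
  apply: (@le_trans _ _ (sg - 1)^-1).
    by apply: le_ln1Dx; apply: (@lt_trans _ _ 0); [lra|rewrite invr_gt0; lra].
  by rewrite lef_pV2 ?posrE; lra.
have s2 : 0 < sg - 2 by lra.
rewrite -sE -ler_pdivlMl // [leRHS]mulrC.
apply: (le_trans lnT); apply: (le_trans ent).
rewrite -[leRHS]mulrA; apply: ler_wpM2l => //.
have -> : ln d%:R + e * ln q = ln (d%:R * sg).
  have sg0 : 0 < sg by lra.
  have lnsg : ln sg = e * ln q by rewrite sE ln_powR.
  by rewrite lnM ?posrE // ?ltr0n // lnsg.
have -> : (1 + q / (q - 1) * ln (d%:R * sg)) / (sg - 2) = (sg - 2)^-1 + p * ln (d%:R * sg).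
  by rewrite /p; field; rewrite !lt0r_neq0 //; lra.
by rewrite lerD2r.
Qed.

End Bounds.

(** * Passage to the limit in q *)

Section Asymptotics.
Variable R : realType.
Implicit Types (d : nat) (e : R).

Lemma const_A_gt0 d e : (2 <= d)%N -> 0 < e -> 0 < const_A d e.
Proof.
move=> d2 e0; rewrite /const_A ltr_pwDl ?mulr_gt0 ?ltr0n //; exact: leq_trans d2.
Qed.

(** The bound of [metric_dim_lower] solved for the metric dimension and divided by q^e, the factor
    ln q being cancelled so that n occurs only in terms that converge. *)
Definition lower_coef d e (n : nat) : R :=
  (1 - 2 * (n%:R `^ e)^-1) * const_A d e /
  ((ln n%:R)^-1 + (1 - n%:R^-1)^-1 * (ln d%:R * (ln n%:R)^-1 + e)).

Lemma lower_coef_cvg d e : 0 < e ->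
  lower_coef d e n @[n --> \oo] --> const_A d e / e.
Proof.
move=> e0.
have -> : const_A d e / e = (1 - 2 * 0) * const_A d e /
    (0 + (1 - 0)^-1 * (ln d%:R * 0 + e)) :> R.
  by rewrite !mulr0 !subr0 !add0r invr1 !mul1r.
apply: cvgM.
  apply: cvgMl; apply: cvgB; first exact: cvg_cst.
  by apply: cvgMr; apply: cvg_inv_powR_nat.
apply: cvgV; first by rewrite mulr0 !add0r subr0 invr1 mul1r lt0r_neq0.
apply: cvgD; first exact: cvg_inv_ln_nat.
apply: cvgM.
  apply: cvgV; first by rewrite subr0 oner_neq0.
  apply: cvgB; first exact: cvg_cst.
  by have := cvg_inv_powR_nat (@ltr01 R); under eq_fun do rewrite powRr1 //.
apply: cvgD; last exact: cvg_cst.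
by apply: cvgMr; apply: cvg_inv_ln_nat.
Qed.

Lemma lower_coef_le t d (F : finFieldType) (PS : polar_space t d F) :
  let e := type_param R t in
  (2 <= d)%N -> 0 < e -> (9 <= #|F|)%N ->
  lower_coef d e #|F| * (#|F|%:R `^ e) <= (metric_dim (dual_polar_adj PS))%:R.
Proof.
move=> e d2 e0 q9.
have := @metric_dim_lower R t d F PS (ltnW d2) e0 q9; rewrite -/e.
have q9R : 9 <= #|F|%:R :> R by rewrite (ler_nat R 9).
rewrite /lower_coef.
set q : R := #|F|%:R in q9R *; set m : R := _%:R; set A := const_A d e => lo.
have lnq : 0 < ln q by apply: ln_gt0; lra.
have lnd : 0 <= ln d%:R :> R by apply: ln_ge0; rewrite ler1n ltnW.
have qe : 0 < q `^ e by apply: powR_gt0; lra.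
set L := ln q in lnq lo *; set x := q `^ e in qe lo *.
have q1 : 0 < q - 1 by lra.
have i0 : 0 <= L^-1 by rewrite invr_ge0 ltW.
have Den : 0 < L^-1 + (1 - q^-1)^-1 * (ln d%:R * L^-1 + e).
  apply: ltr_wpDl => //; apply: mulr_gt0.
    by rewrite invr_gt0 subr_gt0 invf_lt1; lra.
  by apply: ltr_wpDl => //; apply: mulr_ge0.
rewrite mulrAC ler_pdivrMr // -(ler_pM2r lnq).
have -> : (1 - 2 * x^-1) * A * x * L = (x - 2) * (A * L).
  by field; rewrite lt0r_neq0.
apply: (le_trans lo); rewrite -[leRHS]mulrA ler_wpM2l // le_eqVlt; apply/orP; left; apply/eqP.
by field; rewrite !lt0r_neq0 //; lra.
Qed.

(** Here s - 2 >= 4 and q <= 2 (q - 1). Applied to the generators not opposite a fixed one, it shows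
    that the graph has at most 2 q^A vertices. *)
Lemma double_le_of_fraction (q s N M : nat) :
  (1 < q)%N -> (6 <= s)%N ->
  (M * (s - 2) * q.-1 <= q * N)%N -> (2 * M <= N)%N.
Proof.
move=> q1 s6 h.
have : (M * 4 * q.-1 <= 2 * q.-1 * N)%N.
  apply: (@leq_trans (M * (s - 2) * q.-1)).
    by rewrite leq_mul2r leq_mul2l; apply/orP; right; apply/orP; right; lia.
  by apply: (leq_trans h); rewrite leq_mul2r; lia.
have -> : (M * 4 * q.-1 = (2 * q.-1) * (2 * M))%N by ring.
by rewrite leq_pmul2l //; lia.
Qed.

(** The variable z stands for q^alpha, which lies below both s and q. The constant 56 is 7 * 2 * 4:
    7 from z (6 q + s) <= 7 q s, 2 from s + 1 <= 2 s, and 4 from halving q and s in place of q - 1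
    and s - 2. *)
Lemma unresolved_ratio_le (q s : nat) (z : R) :
  (1 < q)%N -> (6 <= s)%N -> 0 < z -> z <= s%:R -> z <= q%:R ->
  ((6 * q + s - 2) * s.+1)%:R <= 56 * z^-1 * (s * (s - 2) * q.-1)%:R.
Proof.
move=> q1 s6 z0; have s2 : (2 <= s)%N by apply: leq_trans s6.
have E1 : (6 * q + s - 2)%:R = 6 * q%:R + s%:R - 2 :> R.
  have s2' : (2 <= 6 * q + s)%N := leq_trans s2 (leq_addl _ _).
  by rewrite natrB // natrD natrM.
have E2 : (s - 2)%:R = s%:R - 2 :> R by rewrite natrB.
have E3 : q.-1%:R = q%:R - 1 :> R by rewrite -subn1 natrB // ltnW.
have E4 : s.+1%:R = s%:R + 1 :> R by rewrite natr1.
rewrite !natrM E1 E2 E3 E4.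
have {s6} : 6 <= s%:R :> R by rewrite (ler_nat R 6).
have {q1} : 2 <= q%:R :> R by rewrite (ler_nat R 2).
move: q%:R s%:R {E1 E2 E3 E4} => x y x2 y6 zy zx.
rewrite [leRHS]mulrAC ler_pdivlMr // [leLHS]mulrC.
have h1 : z * (6 * x + y) <= 7 * (x * y).
  have : z * x <= y * x by rewrite ler_wpM2r //; lra.
  have : z * y <= x * y by rewrite ler_wpM2r //; lra.
  lra.
have h2 : (6 * x + y - 2) * (y + 1) <= (6 * x + y) * (2 * y) by apply: ler_pM; lra.
have h3 : y * (y / 2) * (x / 2) <= y * (y - 2) * (x - 1).
  have y20 : 0 <= y / 2 by lra.
  have y0 : 0 <= y by lra.
  have y2 : y / 2 <= y - 2 by lra.
  have x20 : 0 <= x / 2 by lra.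
  have x1 : x / 2 <= x - 1 by lra.
  by apply: ler_pM => //; [apply: mulr_ge0|apply: ler_wpM2l].
apply: (@le_trans _ _ (z * ((6 * x + y) * (2 * y)))).
  by apply: ler_wpM2l => //; apply: ltW.
apply: (@le_trans _ _ (7 * (x * y) * (2 * y))).
  by rewrite [leLHS]mulrA; apply: ler_wpM2r h1; lra.
apply: (@le_trans _ _ (56 * (y * (y / 2) * (x / 2)))); first by lra.
by rewrite ler_wpM2l.
Qed.

Lemma metric_dim_upper t d : (2 <= d)%N -> 0 < type_param R t ->
  exists N : nat, forall (F : finFieldType) (PS : polar_space t d F),
    (N <= #|F|)%N ->
    (metric_dim (dual_polar_adj PS))%:R
      <= (const_k d (type_param R t))%:~R * (#|F|%:R `^ type_param R t + 1).
Proof.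
set e := type_param R t; move=> d2 e0.
have A0 := const_A_gt0 d2 e0; set A := const_A d e in A0.
have al0 : 0 < const_alpha e by rewrite /const_alpha lt_min ltr01.
have al1 : const_alpha e <= 1 by rewrite /const_alpha ge_min lexx.
have ale : const_alpha e <= e by rewrite /const_alpha ge_min lexx orbT.
set al := const_alpha e in al0 al1 ale.
have k0 : (0 <= const_k d e)%R.
  by rewrite /const_k addr_ge0 // real_floor_ge0 ?num_real // divr_ge0 ?mulr_ge0 ?ltW.
have kgt : 2 * A / al < (const_k d e)%:~R by rewrite /const_k floorD1_gt.
case: (const_k d e) k0 kgt => // k _; rewrite -pmulrn => kgt.
(* The summand 1 after the floor in [const_k] makes 2 A < alpha k strict, so g is positive and q^g
   outgrows every constant. *)
pose g := al * k%:R - 2 * A.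
have g0 : 0 < g by rewrite /g subr_gt0 [al * _]mulrC -ltr_pdivrMr.
(* The factor 56^k comes from k pencils, and 4 from squaring the bound 2 q^A on the number of
   vertices. *)
have [N NP] := powR_nat_gt (4 * 56 ^+ k) g0.
exists (maxn N 36) => F PS; rewrite geq_max => /andP[/NP qg q36].
have [s [[T0 sq] D_le n0 NO [B [panels [pencils [p0 pc bl]]]]]] :=
  dual_polar_counts PS (ltnW d2).
have sE : s%:R = #|F|%:R `^ e :> R := natr_order R sq.
have s6 : 6 <= s%:R :> R by rewrite sE; apply: (@order_ge R t #|F| 6).
have s6n : (6 <= s)%N by rewrite -(ler_nat R).
have q1 : (1 < #|F|)%N := finNzRing_gt1 F.
rewrite -sE natr1 -natrM ler_nat.
apply: (metric_dim_pencils p0 pc bl).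
rewrite -(ltr_nat R) natrM !natrX.
set T := dual_polar_vertex PS in T0 D_le n0 NO *.
have [x0 _] := card_gt0P T0.
have cT : (#|T| <= 2 * (s ^ d * #|F| ^ 'C(d, 2)))%N.
  have h := double_le_of_fraction q1 s6n (NO x0).
  have hc : (s ^ d * #|F| ^ 'C(d, 2) + #|[pred Y : T | (gdist (dual_polar_adj PS) x0 Y < d)%N]| = #|T|)%N.
    rewrite -(cardC [pred Y : T | gdist (dual_polar_adj PS) x0 Y == d]) n0.
    by congr addn; apply: eq_card => Y; rewrite !inE ltn_neqAle D_le andbT.
  move: h; rewrite -hc mul2n -addnn leq_add2r => h.
  by rewrite mul2n -addnn leq_add2l.
have cTR : #|T|%:R <= 2 * #|F|%:R `^ A :> R.
  by rewrite -(natr_opposite R d (ltnW q1) sq) -natrM ler_nat.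
have q36R : 36 <= #|F|%:R :> R by rewrite (ler_nat R 36).
set a := (_ * s.+1)%N; set b := (s * _ * _)%N; set q : R := #|F|%:R in sE qg q36R cTR *.
have q_al : 0 < q `^ al by apply: powR_gt0; lra.
have aR : a%:R <= 56 * (q `^ al)^-1 * b%:R.
  apply: unresolved_ratio_le => //; first by rewrite sE; apply: ler_powR => //; lra.
  by rewrite -[leRHS]powRr1; [apply: ler_powR => //|]; lra.
have b0 : 0 < b%:R :> R.
  have s2 : (0 < s - 2)%N by rewrite subn_gt0; apply: leq_trans s6n.
  have qm : (0 < #|F|.-1)%N by rewrite -ltnS prednK // ltnW.
  by rewrite ltr0n /b !muln_gt0 s2 qm (leq_trans _ s6n).
apply: (@le_lt_trans _ _ ((56 * (q `^ al)^-1 * b%:R) ^+ k * (2 * q `^ A) ^+ 2)).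
  by apply: ler_pM; rewrite ?exprn_ge0 // lerXn2r ?nnegrE // ?(le_trans _ aR) // ?(le_trans _ cTR).
rewrite exprMn mulrAC -[ltRHS]mul1r ltr_pM2r ?exprn_gt0 //.
have -> : (56 * (q `^ al)^-1) ^+ k * (2 * q `^ A) ^+ 2 = 4 * 56 ^+ k * (q `^ g)^-1.
  have Ek : (q `^ al) ^+ k = q `^ (al * k%:R).
    by rewrite -powR_mulrn ?powR_ge0 // -powRrM.
  have E2 : (q `^ A) ^+ 2 = q `^ (2 * A).
    by rewrite -powR_mulrn ?powR_ge0 // -powRrM mulrC.
  have -> : q `^ g = q `^ (al * k%:R) / q `^ (2 * A).
    by rewrite /g powRB //; apply/implyP => _; rewrite lt0r_neq0 //; lra.
  by rewrite !exprMn exprVn Ek E2 invf_div; ring.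
by rewrite ltr_pdivrMr ?mul1r // powR_gt0; lra.
Qed.

End Asymptotics.

Theorem theorem6p1 (R : realType) (d : nat) (e : R) :
  (2 <= d)%N -> 0 < e ->
  (forall t : polar_type, type_param R t = e ->
    (exists2 o : nat -> R, o n @[n --> \oo] --> (0 : R) &
      forall (F : finFieldType) (P : polar_space t d F),
        (const_A d e / e + o #|F|) * (#|F|%:R `^ e)
          <= (metric_dim (dual_polar_adj P))%:R) /\
    (exists N : nat, forall (F : finFieldType) (P : polar_space t d F),
      (N <= #|F|)%N ->
        (metric_dim (dual_polar_adj P))%:R
          <= (const_k d e)%:~R * (#|F|%:R `^ e + 1))) /\
  (exists c C : R, [/\ 0 < c, 0 < C &
    forall t : polar_type, type_param R t = e ->
    exists N : nat, forall (F : finFieldType) (P : polar_space t d F),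
      (N <= #|F|)%N ->
        c * (#|F|%:R `^ e) <= (metric_dim (dual_polar_adj P))%:R
          <= C * (#|F|%:R `^ e)]).
Proof.
move=> d2 e0.
have A0 := const_A_gt0 d2 e0.
have K0 : 0 < (const_k d e)%:~R :> R.
  apply: le_lt_trans (_ : 0 <= 2 * const_A d e / const_alpha e) (floorD1_gt _).
  by rewrite divr_ge0 ?mulr_ge0 ?ltW // /const_alpha lt_min ltr01.
have c0 : 0 < const_A d e / e / 2 by rewrite !divr_gt0.
split; last first.
  (* Half the limit A / e is eventually below [lower_coef], and 2 k suffices above because q^e + 1
     <= 2 q^e. Both constants are fixed before the type t, since several types may share the same
     e. *)
  exists (const_A d e / e / 2), (2 * (const_k d e)%:~R); split=> //; first by rewrite mulr_gt0.
  move=> t te; have e0t : 0 < type_param R t by rewrite te.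
  have [N1 N1P] := metric_dim_upper d2 e0t; rewrite te in N1P.
  have [N2 _ N2P] : \forall n \near \oo, const_A d e / e / 2 < lower_coef d e n.
    apply: (cvgr_gt _ (@lower_coef_cvg R d e e0)).
    by rewrite ltr_pdivrMr // mulr_natr mulr2n ltrDl divr_gt0.
  exists (maxn N1 (maxn N2 9)) => F PS; rewrite !geq_max => /and3P[qN1 qN2 q9].
  have x0 : 0 <= #|F|%:R `^ e := powR_ge0 _ _.
  apply/andP; split.
    have := @lower_coef_le R t d F PS d2 e0t q9; rewrite te; apply: le_trans.
    by rewrite ler_wpM2r // ltW // N2P.
  apply: (le_trans (N1P F PS qN1)); rewrite -mulrA mulrCA ler_pM2l //.
  rewrite mulr_natl mulr2n lerD2l.
  have q1 : 1 <= #|F|%:R :> R by rewrite ler1n; apply: leq_trans q9.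
  by have := ler_powR q1 (ltW e0); rewrite powRr0.
move=> t te; have e0t : 0 < type_param R t by rewrite te.
split; last by have := metric_dim_upper d2 e0t; rewrite te.
(* Below the threshold 9 of [lower_coef_le] the error term cancels A / e, and the claimed bound
   becomes 0. *)
exists (fun n => if (n < 9)%N then - (const_A d e / e) else lower_coef d e n - const_A d e / e).
  rewrite -(subrr (const_A d e / e)).
  apply: cvg_trans (cvgB (@lower_coef_cvg R d e e0) (cvg_cst _)).
  apply: near_eq_cvg; near=> n.
  by rewrite ltnNge ifN // negbK; near: n; apply: nbhs_infty_ge.
move=> F PS; case: ltnP => q9; first by rewrite subrr mul0r.
by rewrite addrC subrK; have := @lower_coef_le R t d F PS d2 e0t q9; rewrite te.
Unshelve. all: by end_near. Qed.
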